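(* Let $S=\{z\in\mathbb C : |\mathrm{Im}(z)|<\pi\}$ and let $\theta$ be a function holomorphic in $S$ such that $|\theta(z)|<1$ for all $z\in S$ and $\theta(\mathbb R)\subset\mathbb R$. Then there exists a continued $g$-fraction $$g(w)=\cfrac{1}{1+\cfrac{g_1w}{1+\cfrac{(1-g_1)g_2w}{1+\cfrac{(1-g_2)g_3w}{1+\cdots}}}}$$ with $g_k\in[0,1]$ for all $k\ge 1$, such that $$\theta(z)=1-\frac{2}{\mu\,e^{z/2}\,g(e^z-1)+1},\qquad z\in S,$$ where $\mu=\dfrac{1+\theta(0)}{1-\theta(0)}$.
   Context: For a real sequence $g_i\in[0,1]$, $i\ge1$, the $g$-fraction $g(w)=\{g_1,g_2,\dots\mid w\}$ is the limit as $n\to\infty$ of its truncations $$\{g_1,\dots,g_n\mid w\}=\cfrac{1}{1+\cfrac{g_1w}{1+\cfrac{(1-g_1)g_2w}{\ddots+\cfrac{(1-g_{n-1})g_nw}{1}}}}.$$ It is a known result of Wall that this converges, uniformly on compact subsets of $\mathbb H=\mathbb C\setminus(-\infty,-1]$, to an analytic function (if some partial numerator coefficient vanishes, the fraction terminates there). The map $z\mapsto e^z-1$ is a bijection from $S$ onto $\mathbb H$. *)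

(* Defs.v *)
From Stdlib Require Import Reals.
From Coquelicot Require Import Coquelicot.

Open Scope R_scope.
Open Scope C_scope.

Definition Cexp (z : C) : C :=
  RtoC (exp (Re z)) * (cos (Im z), sin (Im z)).

Definition strip (z : C) : Prop := (Rabs (Im z) < PI)%R.

(* The plane cut along the real half-line (-infinity, -1]. *)
Definition cut_plane (w : C) : Prop := ~ (Im w = 0%R /\ (Re w <= -1)%R).

Definition holomorphic_on (D : C -> Prop) (f : C -> C) : Prop :=
  forall z, D z -> ex_derive (K := C_AbsRing) (V := C_NormedModule) f z.

(* Coefficient of the k-th partial numerator, k >= 1; the first one is g_1.
   The value at k = 0 is not used. *)
Definition gcoef (g : nat -> R) (k : nat) : R :=
  match k with
  | O => 0
  | 1%nat => g 1%nat
  | S j => (1 - g j) * g (S j)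
  end.

(* 1 + c_k w / (1 + c_{k+1} w / ( ... / (1 + c_{k+n-1} w / 1))), c = gcoef g. *)
Fixpoint gtail (g : nat -> R) (w : C) (n k : nat) : C :=
  match n with
  | O => 1
  | S m => 1 + RtoC (gcoef g k) * w / gtail g w m (S k)
  end.

(* {g_1, ..., g_n | w}.  A vanishing c_k terminates the fraction at that place,
   since in Coquelicot 0 / x = 0 for every x. *)
Definition gtrunc (g : nat -> R) (n : nat) (w : C) : C :=
  1 / gtail g w n 1.

(* l = {g_1, g_2, ... | w} *)
Definition is_gfraction (g : nat -> R) (w l : C) : Prop :=
  filterlim (fun n => gtrunc g n w) eventually (locally l).

(* Main.v *)
Require Import Defs.
From Stdlib Require Import Reals Lra Lia Psatz Classical ClassicalEpsilon.
From Coquelicot Require Import Coquelicot.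

(* Put T = tanh(z/4), which maps the strip onto the unit disc and satisfies
   e^(z/2) = (1+T)/(1-T) and e^z - 1 = 4T/(1-T)^2.  Run the Schur algorithm on h_0 = - theta
   in the variable T, with signs chosen so that h_k = (eta_k - T h_{k+1})/(1 - eta_k T h_{k+1}),
   eta_k = h_k(0); the eta_k lie in [-1,1] because h_k is real on the real line.  With
   g_k = (1 - eta_k)/2 the tails of the g-fraction are
     1 + (1 - g_{k-1}) w / (1 + e^(z/2) (1+h_k)/(1-h_k)),   w = e^z - 1,
   and a truncation amounts to replacing some h_k by 1.  Since multiplication by T contracts
   the hyperbolic metric of the disc, which Moebius maps preserve, the truncations converge.
   The Schwarz lemma behind the Schur step is derived from a maximum principle whose sharp
   constant comes from applying a crude Cauchy estimate to the powers of the function. *)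

Local Open Scope R_scope.
Local Open Scope C_scope.

(** * Complex differentiability *)

(** With x = T h_1, one Schur step gives (1 + theta) / (1 - theta) = mu (1 + x) / (1 - x). So eta_0
    is spent on mu, the sign in h_0 = - theta producing exactly this mu, and the fraction, which
    starts with eta_1, has to represent e^(-z/2) (1 + x) / (1 - x). A tail equals 1 when its h is 1;
    this starting value of a truncation lies at infinite hyperbolic distance, and the first factor T
    makes the distance finite. The obstacle is z = 0: the Schur quotient is known there only to be
    continuous, and holomorphy provides just the existence of a derivative. Goursat's theorem and
    the maximum principle are therefore proved in forms that tolerate points of mere continuity, and
    differentiability at 0 is recovered from them without power series. If eta_k is 1 or -1, then
    h_k is constant; the algorithm goes on with h_{k+1} = 0, so that one infinite sequence serves
    every theta. *)

Lemma continuous_Cmod (f : C -> C) (z : C) :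
  continuous f z <->
  forall eps : R, (0 < eps)%R -> exists delta : R, (0 < delta)%R /\
    forall x : C, (Cmod (x - z) < delta)%R -> (Cmod (f x - f z) < eps)%R.
Proof.
split.
- intros Hf eps Heps.
  assert (H := proj1 (filterlim_locally_ball_norm (K := C_AbsRing)
    (U := C_NormedModule) f (f z)) Hf (mkposreal _ Heps)).
  destruct (locally_norm_le_locally (K := C_AbsRing) (V := C_NormedModule) z _ H)
    as [d Hd].
  exists d; split; [apply cond_pos | exact Hd].
- intros H.
  apply (filterlim_locally_ball_norm (K := C_AbsRing) (U := C_NormedModule) f (f z)).
  intros eps.
  destruct (H eps (cond_pos eps)) as [d [Hd Hb]].
  apply (locally_le_locally_norm (K := C_AbsRing) (V := C_NormedModule)).
  exists (mkposreal d Hd); exact Hb.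
Qed.

Lemma continuous_Re_Im (f : C -> C) (z : C) :
  continuous (fun x => Re (f x)) z -> continuous (fun x => Im (f x)) z ->
  continuous f z.
Proof.
intros H1 H2.
apply filterlim_locally; intros eps.
generalize (filter_and _ _ (proj1 (filterlim_locally _ _) H1 eps)
  (proj1 (filterlim_locally _ _) H2 eps)).
apply filter_imp; intros x [A B]; split; assumption.
Qed.

Lemma continuous_Re (f : C -> C) (z : C) :
  continuous f z -> continuous (fun x => Re (f x)) z.
Proof.
intros H; apply (continuous_comp f Re); [exact H | apply (@continuous_fst R_UniformSpace R_UniformSpace)].
Qed.

Lemma continuous_Im (f : C -> C) (z : C) :
  continuous f z -> continuous (fun x => Im (f x)) z.
Proof.
intros H; apply (continuous_comp f Im); [exact H | apply (@continuous_snd R_UniformSpace R_UniformSpace)].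
Qed.

Lemma continuous_Cplus (f g : C -> C) (z : C) :
  continuous f z -> continuous g z -> continuous (fun x => f x + g x) z.
Proof.
exact (@continuous_plus C_UniformSpace C_AbsRing C_NormedModule f g z).
Qed.

Lemma continuous_Copp (f : C -> C) (z : C) :
  continuous f z -> continuous (fun x => - f x) z.
Proof.
exact (@continuous_opp C_UniformSpace C_AbsRing C_NormedModule f z).
Qed.

Lemma continuous_Cminus (f g : C -> C) (z : C) :
  continuous f z -> continuous g z -> continuous (fun x => f x - g x) z.
Proof.
exact (@continuous_minus C_UniformSpace C_AbsRing C_NormedModule f g z).
Qed.

Lemma continuous_Cmult (f g : C -> C) (z : C) :
  continuous f z -> continuous g z -> continuous (fun x => f x * g x) z.
Proof.
intros Hf Hg.
assert (Hf1 := continuous_Re _ _ Hf); assert (Hf2 := continuous_Im _ _ Hf).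
assert (Hg1 := continuous_Re _ _ Hg); assert (Hg2 := continuous_Im _ _ Hg).
apply continuous_Re_Im.
- apply (continuous_minus (V := R_NormedModule));
    apply (continuous_mult (K := R_AbsRing)); assumption.
- apply (continuous_plus (V := R_NormedModule));
    apply (continuous_mult (K := R_AbsRing)); assumption.
Qed.

Lemma continuous_Cinv (f : C -> C) (z : C) :
  continuous f z -> f z <> 0 -> continuous (fun x => / f x) z.
Proof.
intros Hf Hz.
assert (Hf1 := continuous_Re _ _ Hf); assert (Hf2 := continuous_Im _ _ Hf).
assert (Hn : (Re (f z) ^ 2 + Im (f z) ^ 2 <> 0)%R).
{ intros H; apply Hz; destruct (f z) as [a b]; simpl in H.
  apply injective_projections; simpl; nra. }
assert (Hc : continuous (fun x => / (Re (f x) ^ 2 + Im (f x) ^ 2))%R z).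
{ apply (continuous_comp (fun x => Re (f x) ^ 2 + Im (f x) ^ 2)%R Rinv).
  - apply (continuous_plus (V := R_NormedModule)); simpl;
      repeat apply (continuous_mult (K := R_AbsRing)); try assumption;
      apply continuous_const.
  - apply continuity_pt_filterlim, continuity_pt_inv;
      [apply derivable_continuous_pt, derivable_pt_id | exact Hn]. }
apply continuous_Re_Im.
- apply (continuous_mult (K := R_AbsRing)); assumption.
- apply (continuous_mult (K := R_AbsRing)); [|assumption].
  apply (continuous_opp (V := R_NormedModule)); assumption.
Qed.

Lemma continuous_Cdiv (f g : C -> C) (z : C) :
  continuous f z -> continuous g z -> g z <> 0 ->
  continuous (fun x => f x / g x) z.
Proof.
intros; apply continuous_Cmult; [|apply continuous_Cinv]; assumption.
Qed.

(* Carathéodory's form of complex differentiability: every rule of calculus below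
   reduces to the corresponding rule for continuous functions. *)
Definition Cdiff (f : C -> C) (z : C) : Prop :=
  exists q : C -> C, continuous q z /\ forall x : C, f x = f z + q x * (x - z).

Lemma Cdiff_continuous (f : C -> C) (z : C) : Cdiff f z -> continuous f z.
Proof.
intros [q [Hq H]].
apply (continuous_ext (fun x => f z + q x * (x - z))); [intros; symmetry; apply H|].
apply continuous_Cplus; [apply continuous_const|].
apply continuous_Cmult; [exact Hq|].
apply continuous_Cminus; [apply continuous_id | apply continuous_const].
Qed.

Lemma Ceq_dec_classic (x y : C) : {x = y} + {x <> y}.
Proof. apply excluded_middle_informative. Qed.

Lemma Cminus_neq_0 (x y : C) : x <> y -> x - y <> 0.
Proof. intros H E; apply H; rewrite Ceq_minus; exact E. Qed.

Lemma ex_derive_Cdiff (f : C -> C) (z : C) :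
  ex_derive (K := C_AbsRing) (V := C_NormedModule) f z -> Cdiff f z.
Proof.
intros [l [_ Hl]].
exists (fun x => if Ceq_dec_classic x z then l else (f x - f z) / (x - z)).
split.
- apply continuous_Cmod; intros eps Heps.
  assert (He : (0 < eps / 2)%R) by lra.
  specialize (Hl z (fun P H => H) (mkposreal _ He)).
  destruct Hl as [d Hd].
  exists d; split; [apply cond_pos|].
  intros x Hx.
  destruct (Ceq_dec_classic z z) as [_|n]; [|now elim n].
  destruct (Ceq_dec_classic x z) as [->|n].
  { replace (l - l) with (RtoC 0) by ring; rewrite Cmod_0; exact Heps. }
  specialize (Hd x Hx); change (Cmod ((f x - f z) - (x - z) * l) <= eps / 2 * Cmod (x - z))%R in Hd.
  assert (Hn := Cminus_neq_0 _ _ n).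
  replace ((f x - f z) / (x - z) - l) with (((f x - f z) - (x - z) * l) / (x - z))
    by (field; exact Hn).
  rewrite Cmod_div by exact Hn.
  assert (P := proj1 (Cmod_gt_0 _) Hn).
  apply Rle_lt_trans with (eps / 2)%R; [|lra].
  apply Rmult_le_reg_r with (Cmod (x - z)); [exact P|].
  unfold Rdiv at 1; rewrite Rmult_assoc, Rinv_l, Rmult_1_r by lra; exact Hd.
- intros x; destruct (Ceq_dec_classic x z) as [->|n]; [ring|].
  field; apply Cminus_neq_0, n.
Qed.

Lemma Cdiff_const (c z : C) : Cdiff (fun _ => c) z.
Proof. exists (fun _ => 0); split; [apply continuous_const | intros; ring]. Qed.

Lemma Cdiff_id (z : C) : Cdiff (fun x => x) z.
Proof. exists (fun _ => 1); split; [apply continuous_const | intros; ring]. Qed.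

Lemma Cdiff_ext (f g : C -> C) (z : C) :
  (forall x, f x = g x) -> Cdiff f z -> Cdiff g z.
Proof.
intros E [q [Hq H]]; exists q; split; [exact Hq|].
intros x; rewrite <- !E; apply H.
Qed.

Lemma Cdiff_plus (f g : C -> C) (z : C) :
  Cdiff f z -> Cdiff g z -> Cdiff (fun x => f x + g x) z.
Proof.
intros [q [Hq H]] [r [Hr K]]; exists (fun x => q x + r x); split.
- apply continuous_Cplus; assumption.
- intros x; rewrite (H x), (K x); ring.
Qed.

Lemma Cdiff_mult (f g : C -> C) (z : C) :
  Cdiff f z -> Cdiff g z -> Cdiff (fun x => f x * g x) z.
Proof.
intros Hf; assert (Cf := Cdiff_continuous _ _ Hf); revert Hf.
intros [q [Hq H]] [r [Hr K]]; exists (fun x => q x * g z + f x * r x); split.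
- apply continuous_Cplus; apply continuous_Cmult; try assumption; apply continuous_const.
- intros x; rewrite (K x); rewrite (H x) at 1 2; ring.
Qed.

Lemma Cdiff_opp (f : C -> C) (z : C) : Cdiff f z -> Cdiff (fun x => - f x) z.
Proof.
intros H; apply (Cdiff_ext (fun x => (-(1)) * f x)); [intros; ring|].
apply Cdiff_mult; [apply Cdiff_const | exact H].
Qed.

Lemma Cdiff_minus (f g : C -> C) (z : C) :
  Cdiff f z -> Cdiff g z -> Cdiff (fun x => f x - g x) z.
Proof. intros Hf Hg; apply Cdiff_plus; [exact Hf | apply Cdiff_opp, Hg]. Qed.

Lemma Cdiff_pow (f : C -> C) (n : nat) (z : C) :
  Cdiff f z -> Cdiff (fun x => f x ^ n) z.
Proof.
intros H; induction n as [|n IH]; [apply (Cdiff_const 1)|].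
apply (Cdiff_mult f (fun x => f x ^ n)); assumption.
Qed.

Lemma Cdiff_comp (f g : C -> C) (z : C) :
  Cdiff f z -> Cdiff g (f z) -> Cdiff (fun x => g (f x)) z.
Proof.
intros Hf; assert (Cf := Cdiff_continuous _ _ Hf); revert Hf.
intros [q [Hq H]] [r [Hr K]]; exists (fun x => r (f x) * q x); split.
- apply continuous_Cmult; [|exact Hq].
  apply (continuous_comp f r); assumption.
- intros x; rewrite (K (f x)); rewrite (H x) at 2; ring.
Qed.

Lemma Cdiff_ext_loc (f g : C -> C) (z : C) :
  (exists d : R, (0 < d)%R /\ forall x, (Cmod (x - z) < d)%R -> f x = g x) ->
  Cdiff f z -> Cdiff g z.
Proof.
intros [d [Hd E]] [q [Hq H]].
assert (Ez : f z = g z).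
{ apply E; replace (z - z) with (RtoC 0) by ring; rewrite Cmod_0; exact Hd. }
(* Carathéodory's identity must hold for all [x], so off the disc the slope is the difference
   quotient of [g]; continuity at [z] sees only the disc. *)
exists (fun x => if Rlt_dec (Cmod (x - z)) d then q x else (g x - g z) / (x - z)).
split.
- apply (continuous_ext_loc _ q); [|exact Hq].
  apply (locally_le_locally_norm (K := C_AbsRing) (V := C_NormedModule)).
  exists (mkposreal d Hd); intros x Hx.
  destruct (Rlt_dec (Cmod (x - z)) d) as [_|n]; [reflexivity | now elim n].
- intros x; destruct (Rlt_dec (Cmod (x - z)) d) as [l|n].
  + rewrite <- Ez, <- (E x l); apply H.
  + field; intros E0; apply n; rewrite E0, Cmod_0; exact Hd.
Qed.

Lemma Cdiff_inv (f : C -> C) (z : C) :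
  Cdiff f z -> f z <> 0 -> Cdiff (fun x => / f x) z.
Proof.
intros Hf Hz.
apply (Cdiff_comp f Cinv z Hf).
assert (P := proj1 (Cmod_gt_0 _) Hz).
(* This is 1/x = 1/c - (x - c)/(c x) with [c = f z]. The dummy value at [x = 0] keeps the
   denominator of the slope nonzero everywhere, and the comparison with the inverse takes place on
   the disc of radius [Cmod (f z)], which avoids 0. *)
apply (Cdiff_ext_loc (fun x => / f z + (- / (f z * (if Ceq_dec_classic x 0 then f z else x)))
  * (x - f z))).
- exists (Cmod (f z)); split; [exact P|].
  intros x Hx; destruct (Ceq_dec_classic x 0) as [->|n].
  { elim (Rlt_irrefl (Cmod (f z))); rewrite <- (Cmod_opp (f z)) at 1.
    replace (- f z) with (0 - f z) by ring; exact Hx. }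
  field; split; assumption.
- exists (fun x => - / (f z * (if Ceq_dec_classic x 0 then f z else x))); split.
  + apply continuous_Copp, continuous_Cinv.
    * apply continuous_Cmult; [apply continuous_const|].
      apply (continuous_ext_loc _ (fun x => x)); [|apply continuous_id].
      apply (locally_le_locally_norm (K := C_AbsRing) (V := C_NormedModule)).
      exists (mkposreal _ P); intros x Hx.
      change (Cmod (x - f z) < Cmod (f z))%R in Hx.
      destruct (Ceq_dec_classic x 0) as [->|n]; [|reflexivity].
      elim (Rlt_irrefl (Cmod (f z))); rewrite <- (Cmod_opp (f z)) at 1.
      replace (- f z) with (0 - f z) by ring; exact Hx.
    * destruct (Ceq_dec_classic (f z) 0) as [E|_]; [now elim Hz|].
      apply Cmult_neq_0; assumption.
  + intros x; replace (f z - f z) with (RtoC 0) by ring; ring.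
Qed.

Lemma Cdiff_div (f g : C -> C) (z : C) :
  Cdiff f z -> Cdiff g z -> g z <> 0 -> Cdiff (fun x => f x / g x) z.
Proof. intros; apply Cdiff_mult; [|apply Cdiff_inv]; assumption. Qed.

(** A zero of [g] turns mere continuity of [f] into differentiability of the product. Polynomial
    factors absorb exceptional points in this way in the applications of the maximum principle. *)
Lemma Cdiff_mult_vanish (f g : C -> C) (z : C) :
  continuous f z -> Cdiff g z -> g z = 0 -> Cdiff (fun x => f x * g x) z.
Proof.
intros Hf [q [Hq H]] E; exists (fun x => f x * q x); split.
- apply continuous_Cmult; assumption.
- intros x; rewrite (H x), E; ring.
Qed.

Lemma locally_neq (z p : C) : z <> p ->
  exists d : R, (0 < d)%R /\ forall x, (Cmod (x - z) < d)%R -> x <> p.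
Proof.
intros H; exists (Cmod (p - z)); split.
- apply Cmod_gt_0, Cminus_neq_0; congruence.
- intros x Hx ->; exact (Rlt_irrefl _ Hx).
Qed.

Lemma slope_Cdiff (f q : C -> C) (p z : C) :
  (forall x, f x = f p + q x * (x - p)) -> z <> p -> Cdiff f z -> Cdiff q z.
Proof.
intros H Hz Hf.
destruct (locally_neq z p Hz) as [d [Hd E]].
apply (Cdiff_ext_loc (fun x => (f x - f p) / (x - p))).
- exists d; split; [exact Hd|]; intros x Hx.
  rewrite (H x); field; apply Cminus_neq_0, E, Hx.
- apply Cdiff_div; [| |apply Cminus_neq_0, Hz]; apply Cdiff_minus;
    try apply Cdiff_const; [exact Hf | apply Cdiff_id].
Qed.

Lemma slope_continuous (f q : C -> C) (p z : C) :
  (forall x, f x = f p + q x * (x - p)) -> z <> p -> continuous f z -> continuous q z.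
Proof.
intros H Hz Hf.
destruct (locally_neq z p Hz) as [d [Hd E]].
apply (continuous_ext_loc _ (fun x => (f x - f p) / (x - p))).
- apply (locally_le_locally_norm (K := C_AbsRing) (V := C_NormedModule)).
  exists (mkposreal _ Hd); intros x Hx; change ((f x - f p) / (x - p) = q x).
  rewrite (H x); field; apply Cminus_neq_0, E, Hx.
- apply continuous_Cdiv; [| |apply Cminus_neq_0, Hz]; apply continuous_Cminus;
    try apply continuous_const; [exact Hf | apply continuous_id].
Qed.

(** * Goursat's theorem for rectangles *)

(** Serves both the nested rectangles of Goursat's theorem and the Schur algorithm. [next] is total
    because [epsilon] picks something arbitrary where no successor exists; the invariant [P] rules
    that case out by induction. *)
Lemma dependent_choice (A : Type) (P : nat -> A -> Prop)
  (R : nat -> A -> A -> Prop) (a0 : A) :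
  P O a0 ->
  (forall n a, P n a -> exists a', P (S n) a' /\ R n a a') ->
  exists u : nat -> A, u O = a0 /\
    forall n, P n (u n) /\ R n (u n) (u (S n)).
Proof.
intros H0 HS.
set (next := fun n a => epsilon (inhabits a) (fun a' => P (S n) a' /\ R n a a')).
set (u := fix u n := match n with O => a0 | S m => next m (u m) end).
assert (E : forall n, P n (u n) -> P (S n) (u (S n)) /\ R n (u n) (u (S n))).
{ intros n Hn; exact (epsilon_spec (inhabits (u n)) _ (HS n (u n) Hn)). }
assert (HP : forall n, P n (u n)).
{ induction n as [|n IH]; [exact H0 | apply E, IH]. }
exists u; split; [reflexivity|]; intros n; split; [apply HP | apply E, HP].
Qed.

Lemma nested_intervals (u v : nat -> R) :
  (forall n, u n <= u (S n))%R -> (forall n, v (S n) <= v n)%R ->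
  (forall n, u n <= v n)%R ->
  exists p : R, forall n, (u n <= p <= v n)%R.
Proof.
intros Hu Hv Huv.
assert (H : forall n m, (u n <= v m)%R).
{ intros n m.
  apply Rle_trans with (u (max n m)).
  { apply Rge_le, growing_prop; [exact Hu | lia]. }
  apply Rle_trans with (v (max n m)); [apply Huv|].
  apply (decreasing_prop v m (max n m)); [exact Hv | lia]. }
destruct (completeness (fun x => exists n, x = u n)) as [p [Hp Hl]].
- exists (v O); intros x [n ->]; apply H.
- exists (u O), O; reflexivity.
- exists p; intros n; split; [apply Hp; exists n; reflexivity|].
  apply Hl; intros x [m ->]; apply H.
Qed.

(** * Integration along the border of a rectangle *)

Definition in_rect (a b c d : R) (z : C) : Prop :=
  (a <= Re z <= b /\ c <= Im z <= d)%R.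

Definition on_border (a b c d : R) (z : C) : Prop :=
  in_rect a b c d z /\ (Re z = a \/ Re z = b \/ Im z = c \/ Im z = d).

(* The real part of the integral of [f] along the border of [a,b] x [c,d]. *)
Definition rect_int (f : C -> C) (a b c d : R) : R :=
  (RInt (fun x => Re (f (x, c)) - Re (f (x, d))) a b +
   RInt (fun y => Im (f (a, y)) - Im (f (b, y))) c d)%R.

Lemma RInt_Rplus (u v w : R -> R) (a b : R) :
  (forall x, w x = (u x + v x)%R) -> ex_RInt u a b -> ex_RInt v a b ->
  RInt w a b = (RInt u a b + RInt v a b)%R.
Proof.
intros E Hu Hv.
rewrite (RInt_ext w (fun x => plus (u x) (v x))) by (intros; apply E).
exact (RInt_plus (V := R_CompleteNormedModule) u v a b Hu Hv).
Qed.

Lemma continuous_pair_l (y x : R) : continuous (fun t : R => (t, y) : C) x.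
Proof.
apply filterlim_locally; intros eps; exists eps; intros t Ht.
split; [exact Ht | apply ball_center].
Qed.

Lemma continuous_pair_r (x y : R) : continuous (fun t : R => (x, t) : C) y.
Proof.
apply filterlim_locally; intros eps; exists eps; intros t Ht.
split; [apply ball_center | exact Ht].
Qed.

Lemma continuous_hor (f : C -> C) (x y : R) :
  continuous f (x, y) -> continuous (fun t : R => Re (f (t, y))) x.
Proof.
intros H.
apply (continuous_comp (fun t : R => (t, y) : C) (fun z => Re (f z))).
- apply continuous_pair_l.
- apply continuous_Re, H.
Qed.

Lemma continuous_ver (f : C -> C) (x y : R) :
  continuous f (x, y) -> continuous (fun t : R => Im (f (x, t))) y.
Proof.
intros H.
apply (continuous_comp (fun t : R => (x, t) : C) (fun z => Im (f z))).
- apply continuous_pair_r.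
- apply continuous_Im, H.
Qed.

Lemma continuous_hor2 (f : C -> C) (a b c d x : R) :
  (c <= d)%R -> (a <= x <= b)%R ->
  (forall z, on_border a b c d z -> continuous f z) ->
  continuous (fun x : R => Re (f (x, c)) - Re (f (x, d)))%R x.
Proof.
intros Hcd Hx H.
apply (continuous_minus (V := R_NormedModule)); apply continuous_hor, H;
  (split; [split; simpl; lra | simpl; lra]).
Qed.

Lemma continuous_ver2 (f : C -> C) (a b c d y : R) :
  (a <= b)%R -> (c <= y <= d)%R ->
  (forall z, on_border a b c d z -> continuous f z) ->
  continuous (fun y : R => Im (f (a, y)) - Im (f (b, y)))%R y.
Proof.
intros Hab Hy H.
apply (continuous_minus (V := R_NormedModule)); apply continuous_ver, H;
  (split; [split; simpl; lra | simpl; lra]).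
Qed.

Lemma ex_RInt_hor (f : C -> C) (a b c d : R) :
  (a <= b)%R -> (c <= d)%R ->
  (forall z, on_border a b c d z -> continuous f z) ->
  ex_RInt (fun x : R => Re (f (x, c)) - Re (f (x, d)))%R a b.
Proof.
intros Hab Hcd H; apply (ex_RInt_continuous (V := R_CompleteNormedModule)).
intros x; rewrite Rmin_left, Rmax_right by lra; intros Hx.
apply (continuous_hor2 f a b c d); assumption.
Qed.

Lemma ex_RInt_ver (f : C -> C) (a b c d : R) :
  (a <= b)%R -> (c <= d)%R ->
  (forall z, on_border a b c d z -> continuous f z) ->
  ex_RInt (fun y : R => Im (f (a, y)) - Im (f (b, y)))%R c d.
Proof.
intros Hab Hcd H; apply (ex_RInt_continuous (V := R_CompleteNormedModule)).
intros x; rewrite Rmin_left, Rmax_right by lra; intros Hx.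
apply (continuous_ver2 f a b c d); assumption.
Qed.

Lemma rect_int_ext (f g : C -> C) (a b c d : R) :
  (a <= b)%R -> (c <= d)%R ->
  (forall z, on_border a b c d z -> f z = g z) ->
  rect_int f a b c d = rect_int g a b c d.
Proof.
intros Hab Hcd H; unfold rect_int; f_equal; apply RInt_ext; intros x;
  rewrite Rmin_left, Rmax_right by lra; intros Hx;
  (rewrite !H; [reflexivity | |]; (split; [split; simpl; lra | simpl; lra])).
Qed.

Lemma rect_int_plus (f g : C -> C) (a b c d : R) :
  (a <= b)%R -> (c <= d)%R ->
  (forall z, on_border a b c d z -> continuous f z) ->
  (forall z, on_border a b c d z -> continuous g z) ->
  rect_int (fun z => f z + g z) a b c d = (rect_int f a b c d + rect_int g a b c d)%R.
Proof.
intros Hab Hcd Hf Hg; unfold rect_int.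
rewrite (RInt_Rplus (fun x => Re (f (x, c)) - Re (f (x, d)))%R
  (fun x => Re (g (x, c)) - Re (g (x, d)))%R _ a b);
  [| intros; unfold Re; simpl; ring | apply ex_RInt_hor; assumption | apply ex_RInt_hor; assumption].
rewrite (RInt_Rplus (fun y => Im (f (a, y)) - Im (f (b, y)))%R
  (fun y => Im (g (a, y)) - Im (g (b, y)))%R _ c d);
  [| intros; unfold Im; simpl; ring | apply ex_RInt_ver; assumption | apply ex_RInt_ver; assumption].
ring.
Qed.

(** For an affine function the difference between opposite sides is constant, [Im q * (d - c)] for
    one pair and [- (Im q * (b - a))] for the other, so the two integrals cancel. *)
Lemma rect_int_affine (p q r : C) (a b c d : R) :
  rect_int (fun z => p + q * (z - r)) a b c d = 0%R.
Proof.
unfold rect_int.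
transitivity (RInt (fun _ => Im q * (d - c))%R a b + RInt (fun _ => - (Im q * (b - a)))%R c d)%R.
- f_equal; apply RInt_ext; intros; destruct p, q, r; unfold Re, Im; simpl; ring.
- rewrite !RInt_const; unfold scal; simpl; unfold mult; simpl; ring.
Qed.

Lemma Re_abs_le (z : C) : (Rabs (Re z) <= Cmod z)%R.
Proof. eapply Rle_trans; [apply Rmax_l | apply Rmax_Cmod]. Qed.

Lemma Im_abs_le (z : C) : (Rabs (Im z) <= Cmod z)%R.
Proof. eapply Rle_trans; [apply Rmax_r | apply Rmax_Cmod]. Qed.

Lemma rect_int_bound (f : C -> C) (a b c d B : R) :
  (a <= b)%R -> (c <= d)%R ->
  (forall z, on_border a b c d z -> continuous f z) ->
  (forall z, on_border a b c d z -> Cmod (f z) <= B)%R ->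
  (Rabs (rect_int f a b c d) <= 2 * ((b - a) + (d - c)) * B)%R.
Proof.
intros Hab Hcd Hf HB; unfold rect_int.
eapply Rle_trans; [apply Rabs_triang|].
replace (2 * ((b - a) + (d - c)) * B)%R
  with ((b - a) * (2 * B) + (d - c) * (2 * B))%R by ring.
assert (K : forall u v, (Rabs u <= B -> Rabs v <= B -> Rabs (u - v) <= 2 * B)%R).
{ intros u v Hu Hv; unfold Rminus; eapply Rle_trans; [apply Rabs_triang|].
  rewrite Rabs_Ropp; lra. }
apply Rplus_le_compat; apply abs_RInt_le_const; try assumption.
- apply ex_RInt_hor; assumption.
- intros x Hx; apply K; (eapply Rle_trans; [apply Re_abs_le|]); apply HB;
    (split; [split; simpl; lra | simpl; lra]).
- apply ex_RInt_ver; assumption.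
- intros x Hx; apply K; (eapply Rle_trans; [apply Im_abs_le|]); apply HB;
    (split; [split; simpl; lra | simpl; lra]).
Qed.

Lemma rect_int_split_ver (f : C -> C) (a m b c d : R) :
  (a <= m)%R -> (m <= b)%R -> (c <= d)%R ->
  (forall z, in_rect a b c d z -> (Re z = m \/ on_border a b c d z) -> continuous f z) ->
  rect_int f a b c d = (rect_int f a m c d + rect_int f m b c d)%R.
Proof.
intros Ham Hmb Hcd H.
assert (Hb : forall z, on_border a b c d z -> continuous f z).
{ intros z Hz; apply H; [apply Hz | right; exact Hz]. }
assert (Hl : forall z, on_border a m c d z -> continuous f z).
{ intros z [[[? ?] ?] Hz]; apply H; [split; lra|].
  destruct (Req_dec (Re z) m); [now left|]; right; split; [split|]; lra. }
assert (Hr : forall z, on_border m b c d z -> continuous f z).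
{ intros z [[[? ?] ?] Hz]; apply H; [split; lra|].
  destruct (Req_dec (Re z) m); [now left|]; right; split; [split|]; lra. }
unfold rect_int.
rewrite <- (RInt_Chasles (fun x => Re (f (x, c)) - Re (f (x, d)))%R a m b);
  [| apply ex_RInt_hor; assumption | apply ex_RInt_hor; assumption].
rewrite (RInt_Rplus (fun y => Im (f (a, y)) - Im (f (m, y)))%R
  (fun y => Im (f (m, y)) - Im (f (b, y)))%R _ c d);
  [| intros; ring | apply ex_RInt_ver; assumption | apply ex_RInt_ver; assumption].
unfold plus; simpl; ring.
Qed.

Lemma rect_int_split_hor (f : C -> C) (a b c m d : R) :
  (a <= b)%R -> (c <= m)%R -> (m <= d)%R ->
  (forall z, in_rect a b c d z -> (Im z = m \/ on_border a b c d z) -> continuous f z) ->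
  rect_int f a b c d = (rect_int f a b c m + rect_int f a b m d)%R.
Proof.
intros Hab Hcm Hmd H.
assert (Hb : forall z, on_border a b c d z -> continuous f z).
{ intros z Hz; apply H; [apply Hz | right; exact Hz]. }
assert (Hl : forall z, on_border a b c m z -> continuous f z).
{ intros z [[[? ?] ?] Hz]; apply H; [split; lra|].
  destruct (Req_dec (Im z) m); [now left|]; right; split; [split|]; lra. }
assert (Hr : forall z, on_border a b m d z -> continuous f z).
{ intros z [[[? ?] ?] Hz]; apply H; [split; lra|].
  destruct (Req_dec (Im z) m); [now left|]; right; split; [split|]; lra. }
unfold rect_int.
rewrite <- (RInt_Chasles (fun y => Im (f (a, y)) - Im (f (b, y)))%R c m d);
  [| apply ex_RInt_ver; assumption | apply ex_RInt_ver; assumption].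
rewrite (RInt_Rplus (fun x => Re (f (x, c)) - Re (f (x, m)))%R
  (fun x => Re (f (x, m)) - Re (f (x, d)))%R _ a b);
  [| intros; ring | apply ex_RInt_hor; assumption | apply ex_RInt_hor; assumption].
unfold plus; simpl; ring.
Qed.

Lemma rect_int_quarter (f : C -> C) (a c s t : R) :
  (0 <= s)%R -> (0 <= t)%R ->
  (forall z, in_rect a (a + 2 * s) c (c + 2 * t) z -> continuous f z) ->
  exists a' c' : R, (a <= a' <= a + s /\ c <= c' <= c + t /\
    Rabs (rect_int f a (a + 2 * s) c (c + 2 * t)) <=
      4 * Rabs (rect_int f a' (a' + s) c' (c' + t)))%R.
Proof.
intros Hs Ht H.
rewrite (rect_int_split_ver f a (a + s)) by (try lra; intros; apply H; assumption).
rewrite (rect_int_split_hor f a (a + s) c (c + t))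
  by (try lra; intros z [? ?] _; apply H; split; lra).
rewrite (rect_int_split_hor f (a + s) (a + 2 * s) c (c + t))
  by (try lra; intros z [? ?] _; apply H; split; lra).
replace (a + 2 * s)%R with (a + s + s)%R by ring.
replace (c + 2 * t)%R with (c + t + t)%R by ring.
set (A := rect_int f a _ c _); set (B := rect_int f a _ (c + t) _).
set (D := rect_int f (a + s) _ c _); set (E := rect_int f (a + s) _ (c + t) _).
assert (K : (Rabs (A + B + (D + E)) <= 4 * Rabs A \/ Rabs (A + B + (D + E)) <= 4 * Rabs B \/
  Rabs (A + B + (D + E)) <= 4 * Rabs D \/ Rabs (A + B + (D + E)) <= 4 * Rabs E)%R).
{ assert (T : (Rabs (A + B + (D + E)) <= Rabs A + Rabs B + (Rabs D + Rabs E))%R).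
  { eapply Rle_trans; [apply Rabs_triang|].
    apply Rplus_le_compat; apply Rabs_triang. }
  lra. }
destruct K as [K|[K|[K|K]]]; [exists a, c | exists a, (c + t)%R | exists (a + s)%R, c
  | exists (a + s)%R, (c + t)%R]; (split; [lra|split; [lra|exact K]]).
Qed.

Lemma Cmod_le_Re_Im (z : C) : (Cmod z <= Rabs (Re z) + Rabs (Im z))%R.
Proof.
unfold Cmod; apply Rsqr_incr_0_var.
- rewrite Rsqr_sqrt by nra.
  assert (H1 := Rabs_pos (Re z)); assert (H2 := Rabs_pos (Im z)).
  unfold Re, Im, Rsqr in *.
  rewrite <- (Rsqr_pow2 (fst z)), <- (Rsqr_pow2 (snd z)), (Rsqr_abs (fst z)),
    (Rsqr_abs (snd z)); unfold Rsqr; nra.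
- assert (H1 := Rabs_pos (Re z)); assert (H2 := Rabs_pos (Im z)); lra.
Qed.

Lemma in_rect_dist (a b c d : R) (z p : C) :
  in_rect a b c d z -> in_rect a b c d p -> (Cmod (z - p) <= (b - a) + (d - c))%R.
Proof.
intros [Hz1 Hz2] [Hp1 Hp2]; eapply Rle_trans; [apply Cmod_le_Re_Im|].
apply Rplus_le_compat; apply Rabs_le; destruct z, p; simpl in *; lra.
Qed.

(** The affine part of [f] at [p] integrates to 0, which leaves [(q z - q p) * (z - p)]. The bound
    is quadratic because one factor [b - a + (d - c)] comes from the length of the border and one
    from [z - p]. *)
Lemma rect_int_linear_approx (f : C -> C) (p : C) (eps : R) :
  Cdiff f p -> (0 < eps)%R -> exists delta : R, (0 < delta)%R /\
    forall a b c d, (a <= b)%R -> (c <= d)%R -> in_rect a b c d p ->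
      (b - a + (d - c) < delta)%R ->
      (forall z, in_rect a b c d z -> continuous f z) ->
      (Rabs (rect_int f a b c d) <= 2 * eps * ((b - a) + (d - c)) ^ 2)%R.
Proof.
intros [q [Hq Hf]] He.
destruct (proj1 (continuous_Cmod q p) Hq eps He) as [delta [Hd Hb]].
exists delta; split; [exact Hd|].
intros a b c d Hab Hcd Hp Hs Hc.
set (r := fun z => f z + (- (f p) + (- q p) * (z - p))).
assert (Cr : forall z, in_rect a b c d z -> continuous r z).
{ intros z Hz; apply continuous_Cplus; [apply Hc, Hz|].
  apply continuous_Cplus; [apply continuous_const|].
  apply continuous_Cmult; [apply continuous_const|].
  apply continuous_Cminus; [apply continuous_id | apply continuous_const]. }
assert (E : rect_int f a b c d = rect_int r a b c d).
{ rewrite <- (Rplus_0_r (rect_int r a b c d)), <- (rect_int_affine (f p) (q p) p a b c d).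
  rewrite <- rect_int_plus; try assumption.
  - apply rect_int_ext; try assumption; intros; unfold r; ring.
  - intros z [Hz _]; apply Cr, Hz.
  - intros z [Hz _]; apply continuous_Cplus; [apply continuous_const|].
    apply continuous_Cmult; [apply continuous_const|].
    apply continuous_Cminus; [apply continuous_id | apply continuous_const]. }
rewrite E.
replace (2 * eps * (b - a + (d - c)) ^ 2)%R
  with (2 * (b - a + (d - c)) * (eps * (b - a + (d - c))))%R by ring.
apply rect_int_bound; try assumption.
- intros z [Hz _]; apply Cr, Hz.
- intros z [Hz _]; unfold r.
  replace (f z + (- f p + - q p * (z - p))) with ((q z - q p) * (z - p))
    by (rewrite (Hf z); ring).
  assert (Hzp := in_rect_dist a b c d z p Hz Hp).
  rewrite Cmod_mult; apply Rmult_le_compat; try apply Cmod_ge_0; [|exact Hzp].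
  apply Rlt_le, Hb; lra.
Qed.

Lemma half_pow_small (s eps : R) : (0 < eps)%R -> exists n : nat, (s / 2 ^ n < eps)%R.
Proof.
intros He.
destruct (pow_lt_1_zero (/ 2) ltac:(rewrite Rabs_pos_eq; lra) (eps / (Rabs s + 1))) as [n Hn].
{ apply Rdiv_lt_0_compat; [exact He|]; assert (H := Rabs_pos s); lra. }
exists n; specialize (Hn n (le_n n)).
assert (P : (0 < 2 ^ n)%R) by (apply pow_lt; lra).
assert (Q := Rabs_pos s); assert (Q' := Rle_abs s).
rewrite pow_inv, Rabs_pos_eq in Hn by (apply Rlt_le, Rinv_0_lt_compat, P).
apply (Rmult_lt_compat_r (Rabs s + 1)) in Hn; [|lra].
replace (eps / (Rabs s + 1) * (Rabs s + 1))%R with eps in Hn by (field; lra).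
assert (0 < / 2 ^ n)%R by (apply Rinv_0_lt_compat, P).
unfold Rdiv; nra.
Qed.

Lemma goursat (f : C -> C) (a b c d : R) :
  (a <= b)%R -> (c <= d)%R ->
  (forall z, in_rect a b c d z -> Cdiff f z) -> rect_int f a b c d = 0%R.
Proof.
intros Hab Hcd Hf.
set (s := fun n : nat => ((b - a) / 2 ^ n)%R).
set (t := fun n : nat => ((d - c) / 2 ^ n)%R).
assert (P2 : forall n, (0 < 2 ^ n)%R) by (intros; apply pow_lt; lra).
assert (Hs : forall n, s n = (2 * s (S n))%R).
{ intros n; specialize (P2 n); unfold s; simpl; field; lra. }
assert (Ht : forall n, t n = (2 * t (S n))%R).
{ intros n; specialize (P2 n); unfold t; simpl; field; lra. }
assert (Hs0 : forall n, (0 <= s n)%R).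
{ intros n; apply Rmult_le_pos; [lra | apply Rlt_le, Rinv_0_lt_compat, P2]. }
assert (Ht0 : forall n, (0 <= t n)%R).
{ intros n; apply Rmult_le_pos; [lra | apply Rlt_le, Rinv_0_lt_compat, P2]. }
set (J := fun n (p : R * R) =>
  Rabs (rect_int f (fst p) (fst p + s n) (snd p) (snd p + t n))).
destruct (dependent_choice (R * R)
  (fun n p => a <= fst p /\ fst p + s n <= b /\ c <= snd p /\ snd p + t n <= d)%R
  (fun n p p' => fst p <= fst p' /\ fst p' + s (S n) <= fst p + s n /\
     snd p <= snd p' /\ snd p' + t (S n) <= snd p + t n /\ J n p <= 4 * J (S n) p')%R
  (a, c)) as [u [Hu0 Hu]].
- unfold s, t; simpl; lra.
- intros n [x y] Hp; simpl in Hp.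
  destruct (rect_int_quarter f x y (s (S n)) (t (S n))) as [x' [y' [Hx [Hy HJ]]]]; try easy.
  { intros z [Hz1 Hz2]; apply Cdiff_continuous, Hf; rewrite <- Hs in Hz1; rewrite <- Ht in Hz2.
    split; lra. }
  rewrite <- Hs, <- Ht in HJ.
  assert (E1 := Hs n); assert (E2 := Ht n).
  exists (x', y'); unfold J; cbn [fst snd].
  repeat split; try lra; exact HJ.
- destruct (nested_intervals (fun n => fst (u n)) (fun n => fst (u n) + s n)%R) as [p1 Hp1].
  { intros n; apply (Hu n). } { intros n; apply (Hu n). }
  { intros n; specialize (Hs0 n); lra. }
  destruct (nested_intervals (fun n => snd (u n)) (fun n => snd (u n) + t n)%R) as [p2 Hp2].
  { intros n; apply (Hu n). } { intros n; apply (Hu n). }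
  { intros n; specialize (Ht0 n); lra. }
  assert (HJ : forall n, (J O (u O) <= 4 ^ n * J n (u n))%R).
  { induction n as [|n IH]; [simpl; lra|].
    destruct (Hu n) as [_ [_ [_ [_ [_ H]]]]].
    assert (0 < 4 ^ n)%R by (apply pow_lt; lra).
    simpl; nra. }
  assert (HJ0 : J O (u O) = Rabs (rect_int f a b c d)).
  { rewrite Hu0; unfold J, s, t; simpl.
    replace (a + (b - a) / 1)%R with b by field.
    replace (c + (d - c) / 1)%R with d by field; reflexivity. }
  apply NNPP; intros Hne.
  assert (Hpos := Rabs_pos_lt _ Hne); rewrite <- HJ0 in Hpos.
  set (L := ((b - a) + (d - c))%R).
  assert (HL : (0 <= L)%R) by (unfold L; lra).
  (* The factor 4 lost at each subdivision is balanced by the square of the halved size, so the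
     estimate becomes [J O (u O) <= 2 * eps * L ^ 2] whatever [n]. This [eps] makes the right side
     smaller than [J O (u O)]; the [+ 1] covers [L = 0]. *)
  set (eps := (J O (u O) / (4 * (L ^ 2 + 1)))%R).
  assert (Heps : (0 < eps)%R) by (apply Rdiv_lt_0_compat; [exact Hpos | nra]).
  assert (Hp : forall n, in_rect (fst (u n)) (fst (u n) + s n) (snd (u n)) (snd (u n) + t n) (p1, p2)).
  { intros n; split; [apply Hp1 | apply Hp2]. }
  destruct (rect_int_linear_approx f (p1, p2) eps) as [delta [Hd HB]].
  { apply Hf; destruct (Hp O) as [A B]; destruct (Hu O) as [C _]; split; simpl in *; lra. }
  { exact Heps. }
  destruct (half_pow_small L delta Hd) as [n Hn].
  specialize (HB (fst (u n)) (fst (u n) + s n)%R (snd (u n)) (snd (u n) + t n)%R).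
  assert (Est : (s n + t n = L / 2 ^ n)%R) by (unfold s, t, L; field; apply Rgt_not_eq, P2).
  replace (fst (u n) + s n - fst (u n) + (snd (u n) + t n - snd (u n)))%R
    with (L / 2 ^ n)%R in HB by (rewrite <- Est; ring).
  assert (HBn : (J n (u n) <= 2 * eps * (L / 2 ^ n) ^ 2)%R).
  { apply HB; try assumption.
    - specialize (Hs0 n); lra.
    - specialize (Ht0 n); lra.
    - apply Hp.
    - intros z [Hz1 Hz2]; apply Cdiff_continuous, Hf.
      destruct (Hu n) as [C _]; split; simpl in *; lra. }
  specialize (HJ n).
  assert (P4 : (0 < 4 ^ n)%R) by (apply pow_lt; lra).
  assert (E4 : (4 ^ n * (L / 2 ^ n) ^ 2 = L ^ 2)%R).
  { replace 4%R with (2 * 2)%R by ring; rewrite Rpow_mult_distr.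
    field; apply Rgt_not_eq, P2. }
  assert (F : (J O (u O) <= 2 * eps * L ^ 2)%R).
  { rewrite <- E4; eapply Rle_trans; [exact HJ|].
    replace (2 * eps * (4 ^ n * (L / 2 ^ n) ^ 2))%R
      with (4 ^ n * (2 * eps * (L / 2 ^ n) ^ 2))%R by ring.
    apply Rmult_le_compat_l; lra. }
  assert (G : (eps * (4 * (L ^ 2 + 1)) = J O (u O))%R) by (unfold eps; field; nra).
  assert (0 <= L ^ 2)%R by nra.
  nra.
Qed.

(** * Maximum principle and removable singularities *)

Lemma Rle_plus_eps_le (x y : R) (K : R) :
  (0 <= K)%R -> (exists e0 : R, 0 < e0 /\ forall e : R, 0 < e -> e <= e0 -> x <= y + K * e)%R -> (x <= y)%R.
Proof.
intros HK [e0 [He0 H]].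
apply Rnot_lt_le; intros Hlt.
set (e := Rmin e0 ((x - y) / (2 * (K + 1)))%R).
assert (P : (0 < (x - y) / (2 * (K + 1)))%R) by (apply Rdiv_lt_0_compat; lra).
assert (He : (0 < e)%R) by (apply Rmin_pos; assumption).
specialize (H e He (Rmin_l _ _)).
assert (H2 : (e <= (x - y) / (2 * (K + 1)))%R) by apply Rmin_r.
apply (Rmult_le_compat_r (2 * (K + 1))) in H2; [|lra].
replace ((x - y) / (2 * (K + 1)) * (2 * (K + 1)))%R with (x - y)%R in H2 by (field; lra).
nra.
Qed.

(** Four cuts isolate [p] in a square of half-side [e]. The four other rectangles vanish by
    Goursat's theorem, and the square contributes at most its perimeter [8 * e] times a local bound
    [M] of [f]. *)
Lemma goursat_exceptional (f : C -> C) (a b c d : R) (p : C) :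
  (a < Re p < b)%R -> (c < Im p < d)%R ->
  (forall z, in_rect a b c d z -> continuous f z) ->
  (forall z, in_rect a b c d z -> z <> p -> Cdiff f z) ->
  rect_int f a b c d = 0%R.
Proof.
destruct p as [p1 p2]; cbn [Re Im fst snd]; intros H1 H2 Hc Hf.
assert (Hp : in_rect a b c d (p1, p2)) by (split; simpl; lra).
destruct (proj1 (continuous_Cmod f (p1, p2)) (Hc _ Hp) 1%R Rlt_0_1) as [delta [Hd HB]].
set (M := (Cmod (f (p1, p2)) + 1)%R).
assert (HM : (0 <= M)%R) by (unfold M; assert (H := Cmod_ge_0 (f (p1, p2))); lra).
enough (H : (Rabs (rect_int f a b c d) <= 0)%R).
{ apply NNPP; intros Hne; assert (Q := Rabs_pos_lt _ Hne); lra. }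
apply (Rle_plus_eps_le _ _ (8 * M)); [lra|].
exists (Rmin (delta / 8) (Rmin (Rmin (p1 - a) (b - p1)) (Rmin (p2 - c) (d - p2))))%R.
split; [repeat apply Rmin_pos; lra|].
intros e He He0.
assert (L1 := Rle_trans _ _ _ He0 (Rmin_l _ _)).
assert (L2 := Rle_trans _ _ _ He0 (Rmin_r _ _)).
assert (L3 := Rle_trans _ _ _ L2 (Rmin_l _ _)).
assert (L4 := Rle_trans _ _ _ L2 (Rmin_r _ _)).
assert (La := Rle_trans _ _ _ L3 (Rmin_l _ _)).
assert (Lb := Rle_trans _ _ _ L3 (Rmin_r _ _)).
assert (Lc := Rle_trans _ _ _ L4 (Rmin_l _ _)).
assert (Ld := Rle_trans _ _ _ L4 (Rmin_r _ _)).
rewrite (rect_int_split_ver f a (p1 - e) b c d)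
  by (try lra; intros z [? ?] _; apply Hc; split; lra).
rewrite (rect_int_split_ver f (p1 - e) (p1 + e) b c d)
  by (try lra; intros z [? ?] _; apply Hc; split; lra).
rewrite (rect_int_split_hor f (p1 - e) (p1 + e) c (p2 - e) d)
  by (try lra; intros z [? ?] _; apply Hc; split; lra).
rewrite (rect_int_split_hor f (p1 - e) (p1 + e) (p2 - e) (p2 + e) d)
  by (try lra; intros z [? ?] _; apply Hc; split; lra).
assert (Hn : forall z, (Re z <> p1 \/ Im z <> p2) -> z <> (p1, p2)).
{ intros z Hz ->; simpl in Hz; lra. }
rewrite (goursat f a (p1 - e) c d)
  by (try lra; (intros z [? ?]; apply Hf;
    [split; lra | apply Hn; first [left; intro; lra | right; intro; lra]])).
rewrite (goursat f (p1 + e) b c d)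
  by (try lra; (intros z [? ?]; apply Hf;
    [split; lra | apply Hn; first [left; intro; lra | right; intro; lra]])).
rewrite (goursat f (p1 - e) (p1 + e) c (p2 - e))
  by (try lra; (intros z [? ?]; apply Hf;
    [split; lra | apply Hn; first [left; intro; lra | right; intro; lra]])).
rewrite (goursat f (p1 - e) (p1 + e) (p2 + e) d)
  by (try lra; (intros z [? ?]; apply Hf;
    [split; lra | apply Hn; first [left; intro; lra | right; intro; lra]])).
replace (0 + (0 + (rect_int f (p1 - e) (p1 + e) (p2 - e) (p2 + e) + 0) + 0))%R
  with (rect_int f (p1 - e) (p1 + e) (p2 - e) (p2 + e)) by ring.
replace (0 + 8 * M * e)%R with (2 * ((p1 + e - (p1 - e)) + (p2 + e - (p2 - e))) * M)%R by ring.
apply rect_int_bound; try lra.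
- intros z [[? ?] _]; apply Hc; split; lra.
- intros z [Hz _].
  assert (D : (Cmod (z - (p1, p2)) < delta)%R).
  { eapply Rle_lt_trans; [apply (in_rect_dist (p1 - e) (p1 + e) (p2 - e) (p2 + e)); [exact Hz|]|];
    [split; simpl; lra | lra]. }
  replace (f z) with ((f z - f (p1, p2)) + f (p1, p2)) by ring.
  eapply Rle_trans; [apply Cmod_triangle|].
  specialize (HB z D); unfold M; lra.
Qed.

Definition in_open_rect (a b c d : R) (z : C) : Prop :=
  (a < Re z < b /\ c < Im z < d)%R.

Lemma on_border_neq (a b c d : R) (z p : C) :
  in_open_rect a b c d p -> on_border a b c d z -> z <> p.
Proof. intros [H1 H2] [_ H] ->; lra. Qed.

Lemma on_border_dist (a b c d : R) (p : C) : in_open_rect a b c d p ->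
  exists r : R, (0 < r)%R /\ forall z, on_border a b c d z -> (r <= Cmod (z - p))%R.
Proof.
intros [H1 H2].
exists (Rmin (Rmin (Re p - a) (b - Re p)) (Rmin (Im p - c) (d - Im p))); split.
{ repeat apply Rmin_pos; lra. }
intros z [_ Hz].
assert (L1 := Rmin_l (Rmin (Re p - a) (b - Re p)) (Rmin (Im p - c) (d - Im p))).
assert (L2 := Rmin_r (Rmin (Re p - a) (b - Re p)) (Rmin (Im p - c) (d - Im p))).
assert (L3 := Rmin_l (Re p - a) (b - Re p)); assert (L4 := Rmin_r (Re p - a) (b - Re p)).
assert (L5 := Rmin_l (Im p - c) (d - Im p)); assert (L6 := Rmin_r (Im p - c) (d - Im p)).
assert (R1 := Re_abs_le (z - p)); assert (R2 := Im_abs_le (z - p)).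
assert (E1 : Re (z - p) = (Re z - Re p)%R) by reflexivity.
assert (E2 : Im (z - p) = (Im z - Im p)%R) by reflexivity.
rewrite E1 in R1; rewrite E2 in R2.
destruct Hz as [E|[E|[E|E]]]; rewrite E in *.
- rewrite Rabs_left in R1 by lra; lra.
- rewrite Rabs_right in R1 by lra; lra.
- rewrite Rabs_left in R2 by lra; lra.
- rewrite Rabs_right in R2 by lra; lra.
Qed.

(** The factor [- Ci] turns the purely imaginary integral of [1 / (z - p)] into a real one, which
    [rect_int] can see. Each of the four sides contributes a positive integrand. *)
Lemma rect_int_kernel_pos (a b c d : R) (p : C) : in_open_rect a b c d p ->
  (0 < rect_int (fun z => - Ci / (z - p))%C a b c d)%R.
Proof.
intros Hp.
assert (Hc : forall z, on_border a b c d z -> continuous (fun z => - Ci / (z - p)) z).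
{ intros z Hz; apply continuous_Cdiv.
  - apply continuous_const.
  - apply continuous_Cminus; [apply continuous_id | apply continuous_const].
  - apply Cminus_neq_0, (on_border_neq a b c d); assumption. }
destruct Hp as [H1 H2].
assert (S : forall u v : R, (u <> 0 \/ v <> 0 -> 0 < u ^ 2 + v ^ 2)%R).
{ intros u v [H|H]; [assert (0 < u ^ 2)%R by nra | assert (0 < v ^ 2)%R by nra]; nra. }
assert (ER : forall z, Re (- Ci / (z - p)) =
  (- (Im z - Im p) / ((Re z - Re p) ^ 2 + (Im z - Im p) ^ 2))%R).
{ intros [z1 z2]; destruct p as [p1 p2]; unfold Re, Im; simpl; unfold Rdiv, Rminus; ring. }
assert (EI : forall z, Im (- Ci / (z - p)) =
  (- (Re z - Re p) / ((Re z - Re p) ^ 2 + (Im z - Im p) ^ 2))%R).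
{ intros [z1 z2]; destruct p as [p1 p2]; unfold Re, Im; simpl; unfold Rdiv, Rminus; ring. }
unfold rect_int; apply Rplus_lt_0_compat; apply RInt_gt_0; try lra.
- intros x Hx; rewrite !ER; cbn [Re Im fst snd].
  assert (0 < - (c - Im p) / ((x - Re p) ^ 2 + (c - Im p) ^ 2))%R
    by (apply Rdiv_lt_0_compat; [lra | apply S; right; lra]).
  assert (0 < (d - Im p) / ((x - Re p) ^ 2 + (d - Im p) ^ 2))%R
    by (apply Rdiv_lt_0_compat; [lra | apply S; right; lra]).
  unfold Rdiv in *; rewrite (Ropp_mult_distr_l_reverse (d - Im p)); lra.
- intros x Hx; apply (continuous_hor2 (fun z => - Ci / (z - p)) a b c d); try assumption; lra.
- intros y Hy; rewrite !EI; cbn [Re Im fst snd].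
  assert (0 < - (a - Re p) / ((a - Re p) ^ 2 + (y - Im p) ^ 2))%R
    by (apply Rdiv_lt_0_compat; [lra | apply S; left; lra]).
  assert (0 < (b - Re p) / ((b - Re p) ^ 2 + (y - Im p) ^ 2))%R
    by (apply Rdiv_lt_0_compat; [lra | apply S; left; lra]).
  unfold Rdiv in *; rewrite (Ropp_mult_distr_l_reverse (b - Re p)); lra.
- intros y Hy; apply (continuous_ver2 (fun z => - Ci / (z - p)) a b c d); try assumption; lra.
Qed.

(* Cauchy's formula with an unspecified constant; the power trick of
   [maximum_principle] makes the value of the constant irrelevant. *)
Lemma cauchy_estimate (a b c d : R) (p : C) : in_open_rect a b c d p ->
  exists K : R, (0 < K)%R /\ forall (k : C -> C) (B : R),
    (forall z, in_rect a b c d z -> Cdiff k z) -> k p = 1 ->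
    (forall z, on_border a b c d z -> Cmod (k z) <= B)%R -> (1 <= K * B)%R.
Proof.
intros Hp.
assert (HP := rect_int_kernel_pos a b c d p Hp).
destruct (on_border_dist a b c d p Hp) as [r [Hr Hdist]].
set (P := rect_int (fun z => - Ci / (z - p)) a b c d) in *.
assert (Hp' := Hp); destruct Hp' as [H1 H2].
set (L := (2 * ((b - a) + (d - c)) / r)%R).
assert (HL : (0 < L)%R) by (apply Rdiv_lt_0_compat; lra).
exists (L / P)%R; split; [apply Rdiv_lt_0_compat; assumption|].
intros k B Hk Hk1 HB.
(* Since [k z = 1 + q z * (z - p)], the kernel times [k] is the kernel plus [- Ci * q]. The slope
   [q] is continuous at [p] and differentiable elsewhere, so the second term integrates to 0. *)
destruct (Hk p) as [q [Hq Eq]]; [split; lra|].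
assert (Cq : forall z, in_rect a b c d z -> continuous q z).
{ intros z Hz; destruct (Ceq_dec_classic z p) as [->|n]; [exact Hq|].
  apply (slope_continuous k q p); try assumption; apply Cdiff_continuous, Hk, Hz. }
assert (J0 : rect_int (fun z => - Ci * q z) a b c d = 0%R).
{ apply (goursat_exceptional _ a b c d p); try assumption.
  - intros z Hz; apply continuous_Cmult; [apply continuous_const | apply Cq, Hz].
  - intros z Hz n; apply Cdiff_mult; [apply Cdiff_const|].
    apply (slope_Cdiff k q p); try assumption; apply Hk, Hz. }
assert (Cinvp : forall u : C -> C, (forall z, in_rect a b c d z -> continuous u z) ->
  forall z, on_border a b c d z -> continuous (fun z => u z / (z - p)) z).
{ intros u Hu z Hz; apply continuous_Cdiv.
  - apply Hu, Hz.
  - apply continuous_Cminus; [apply continuous_id | apply continuous_const].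
  - apply Cminus_neq_0, (on_border_neq a b c d); assumption. }
assert (J1 : rect_int (fun z => (- Ci * k z) / (z - p)) a b c d = P).
{ rewrite <- (Rplus_0_l P), <- J0; unfold P.
  rewrite <- rect_int_plus; try lra.
  - apply rect_int_ext; try lra; intros z Hz.
    rewrite (Eq z), Hk1; field; apply Cminus_neq_0, (on_border_neq a b c d); assumption.
  - intros z [Hz _]; apply continuous_Cmult; [apply continuous_const | apply Cq, Hz].
  - apply (Cinvp (fun _ => - Ci)); intros; apply continuous_const. }
assert (J2 : (P <= L * B)%R).
{ rewrite <- J1 at 1; eapply Rle_trans; [apply Rle_abs|].
  replace (L * B)%R with (2 * ((b - a) + (d - c)) * (B / r))%R by (unfold L; field; lra).
  apply rect_int_bound; try lra.
  - apply (Cinvp (fun z => - Ci * k z)); intros z Hz; apply continuous_Cmult;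
      [apply continuous_const | apply Cdiff_continuous, Hk, Hz].
  - intros z Hz.
    assert (Hn := Cminus_neq_0 _ _ (on_border_neq a b c d z p Hp Hz)).
    rewrite Cmod_div, Cmod_mult, Cmod_opp, Cmod_Ci, Rmult_1_l by exact Hn.
    assert (Hz1 := Hdist z Hz); assert (Hz2 := HB z Hz); assert (Hz3 := Cmod_ge_0 (k z)).
    unfold Rdiv; apply Rmult_le_compat; try lra.
    + apply Rlt_le, Rinv_0_lt_compat; lra.
    + apply Rinv_le_contravar; lra. }
apply Rmult_le_reg_r with P; [exact HP|].
replace (L / P * B * P)%R with (L * B)%R by (field; lra); lra.
Qed.

(* [pi] absorbs the finitely many points at which [f] is only known to be continuous. *)
Lemma maximum_principle (a b c d : R) (p : C) (f pi : C -> C) (M B : R) :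
  in_open_rect a b c d p -> (0 < M)%R ->
  (forall n z, in_rect a b c d z -> Cdiff (fun x => f x ^ n * pi x) z) ->
  (forall z, on_border a b c d z -> Cmod (f z) <= M)%R ->
  (forall z, on_border a b c d z -> Cmod (pi z) <= B)%R ->
  pi p <> 0 -> (Cmod (f p) <= M)%R.
Proof.
intros Hp HM Hd Hf Hpi Hpp.
apply Rnot_lt_le; intros Hlt.
destruct (cauchy_estimate a b c d p Hp) as [K [HK HE]].
assert (Hfp : f p <> 0) by (apply Cmod_gt_0; lra).
assert (Ppi := proj1 (Cmod_gt_0 _) Hpp).
set (x := (M / Cmod (f p))%R).
assert (Hx0 : (0 < x)%R) by (apply Rdiv_lt_0_compat; lra).
assert (Hx1 : (x < 1)%R).
{ apply Rmult_lt_reg_r with (Cmod (f p)); [lra|].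
  unfold x, Rdiv; rewrite Rmult_assoc, Rinv_l by lra; lra. }
assert (HB0 : (0 <= B)%R).
{ destruct Hp as [H1 H2].
  eapply Rle_trans; [apply Cmod_ge_0 | apply (Hpi (a, c))]; split; [split|]; simpl; lra. }
set (W := (K * (B / Cmod (pi p)))%R).
assert (HW : (0 <= W)%R).
{ apply Rmult_le_pos; [lra|].
  apply Rmult_le_pos; [exact HB0 | apply Rlt_le, Rinv_0_lt_compat; lra]. }
(* [K] does not depend on the function, so it serves all the normalised products
   [(f / f p) ^ n * (pi / pi p)]. On the border these are at most [x ^ n * (B / Cmod (pi p))], which
   tends to 0 and contradicts the lower bound 1. *)
assert (Hn : forall n, (1 <= W * x ^ n)%R).
{ intros n.
  replace (W * x ^ n)%R with (K * (x ^ n * (B / Cmod (pi p))))%R by (unfold W; ring).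
  apply (HE (fun z => f z ^ n * pi z * (/ (f p ^ n * pi p)))).
  - intros z Hz; apply Cdiff_mult; [apply Hd, Hz | apply Cdiff_const].
  - field; split; [exact Hpp | apply Cpow_nz, Hfp].
  - intros z Hz.
    rewrite !Cmod_mult, Cmod_inv, Cmod_mult, !Cmod_pow
      by (apply Cmult_neq_0; [apply Cpow_nz, Hfp | exact Hpp]).
    replace (x ^ n * (B / Cmod (pi p)))%R
      with ((M ^ n * B) * / (Cmod (f p) ^ n * Cmod (pi p)))%R.
    + apply Rmult_le_compat_r.
      { apply Rlt_le, Rinv_0_lt_compat, Rmult_lt_0_compat; [apply pow_lt; lra | lra]. }
      apply Rmult_le_compat; try apply Cmod_ge_0.
      * apply pow_le, Cmod_ge_0.
      * apply pow_incr; split; [apply Cmod_ge_0 | apply Hf, Hz].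
      * apply Hpi, Hz.
    + unfold x, Rdiv; rewrite Rpow_mult_distr, pow_inv; field.
      split; [lra | apply pow_nonzero; lra]. }
destruct (pow_lt_1_zero x ltac:(rewrite Rabs_pos_eq; lra) (/ (W + 1))%R) as [n Hn0].
{ apply Rinv_0_lt_compat; lra. }
specialize (Hn0 n (le_n n)); specialize (Hn n).
assert (Hxn : (0 < x ^ n)%R) by (apply pow_lt; lra).
rewrite Rabs_pos_eq in Hn0 by lra.
apply (Rmult_lt_compat_r (W + 1)) in Hn0; [|lra].
rewrite Rinv_l in Hn0 by lra; nra.
Qed.

(** * Removable singularities *)

Lemma Cmod_ge_1_border (z : C) : on_border (-1) 1 (-1) 1 z -> (1 <= Cmod z)%R.
Proof.
intros [_ Hz].
assert (R1 := Re_abs_le z); assert (R2 := Im_abs_le z).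
destruct Hz as [E|[E|[E|E]]]; rewrite E in *.
- rewrite Rabs_left in R1 by lra; lra.
- rewrite Rabs_right in R1 by lra; lra.
- rewrite Rabs_left in R2 by lra; lra.
- rewrite Rabs_right in R2 by lra; lra.
Qed.

(** Completeness is drawn from real Cauchy sequences: the real and imaginary parts of [q] along
    [1 / (n + 1)] converge, and the hypothesis carries the limit over to every approach to 0. *)
Lemma C_cauchy_limit (q : C -> C) :
  (forall eps : R, (0 < eps)%R -> exists delta : R, (0 < delta)%R /\
    forall x y : C, x <> 0 -> y <> 0 -> (Cmod x < delta)%R -> (Cmod y < delta)%R ->
      (Cmod (q x - q y) <= eps)%R) ->
  exists l : C, forall eps : R, (0 < eps)%R -> exists delta : R, (0 < delta)%R /\
    forall x : C, x <> 0 -> (Cmod x < delta)%R -> (Cmod (q x - l) <= eps)%R.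
Proof.
intros H.
set (u := fun n : nat => RtoC (/ (INR n + 1))%R).
assert (Hu0 : forall n, u n <> 0).
{ intros n; apply Cmod_gt_0; unfold u; rewrite Cmod_R.
  assert (0 < / (INR n + 1))%R by (apply Rinv_0_lt_compat; assert (P := pos_INR n); lra).
  rewrite Rabs_pos_eq; lra. }
assert (Hu : forall delta, (0 < delta)%R -> exists N, forall n, (N <= n)%nat -> (Cmod (u n) < delta)%R).
{ intros delta Hd.
  destruct (nfloor_ex (/ delta)) as [N [_ HN]]; [apply Rlt_le, Rinv_0_lt_compat, Hd|].
  exists N; intros n Hn; unfold u; rewrite Cmod_R.
  assert (P := pos_INR n); apply le_INR in Hn.
  rewrite Rabs_pos_eq by (apply Rlt_le, Rinv_0_lt_compat; lra).
  rewrite <- (Rinv_inv delta); apply Rinv_lt_contravar; [|lra].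
  apply Rmult_lt_0_compat; [apply Rinv_0_lt_compat, Hd | lra]. }
assert (Hc : forall eps, (0 < eps)%R -> exists N, forall n m, (N <= n)%nat -> (N <= m)%nat ->
  (Cmod (q (u n) - q (u m)) <= eps)%R).
{ intros eps He; destruct (H eps He) as [delta [Hd HB]]; destruct (Hu delta Hd) as [N HN].
  exists N; intros; apply HB; auto. }
assert (Hlim : forall g : C -> R, (forall x y, Rabs (g x - g y) <= Cmod (x - y))%R ->
  exists l : R, is_lim_seq (fun n => g (q (u n))) l).
{ intros g Hg; apply ex_lim_seq_cauchy_corr; intros eps.
  assert (He : (0 < eps / 2)%R) by (assert (P := cond_pos eps); lra).
  destruct (Hc _ He) as [N HN]; exists N; intros n m Hn Hm.
  eapply Rle_lt_trans; [apply Hg|]; eapply Rle_lt_trans; [apply HN; assumption|].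
  assert (P := cond_pos eps); lra. }
destruct (Hlim Re) as [l1 Hl1].
{ intros x y; exact (Re_abs_le (x - y)). }
destruct (Hlim Im) as [l2 Hl2].
{ intros x y; exact (Im_abs_le (x - y)). }
exists (l1, l2); intros eps He.
assert (He4 : (0 < eps / 4)%R) by lra.
destruct (H _ He4) as [delta [Hd HB]]; exists delta; split; [exact Hd|].
intros x Hx Hxd.
destruct (Hu delta Hd) as [N1 HN1].
destruct (proj2 (is_lim_seq_spec _ _) Hl1 (mkposreal _ He4)) as [N2 HN2].
destruct (proj2 (is_lim_seq_spec _ _) Hl2 (mkposreal _ He4)) as [N3 HN3].
set (n := max N1 (max N2 N3)).
specialize (HN1 n ltac:(lia)); specialize (HN2 n ltac:(lia)); specialize (HN3 n ltac:(lia)).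
simpl in HN2, HN3.
replace (q x - (l1, l2)) with ((q x - q (u n)) + (q (u n) - (l1, l2))) by ring.
eapply Rle_trans; [apply Cmod_triangle|].
assert (A := HB x (u n) Hx (Hu0 n) Hxd HN1).
assert (B := Cmod_le_Re_Im (q (u n) - (l1, l2))).
change (Re (q (u n) - (l1, l2))) with (Re (q (u n)) - l1)%R in B.
change (Im (q (u n) - (l1, l2))) with (Im (q (u n)) - l2)%R in B.
lra.
Qed.

Lemma slope_limit (f : C -> C) (l : C) :
  (forall eps : R, (0 < eps)%R -> exists delta : R, (0 < delta)%R /\
    forall x : C, x <> 0 -> (Cmod x < delta)%R -> (Cmod ((f x - f 0) / x - l) <= eps)%R) ->
  exists q : C -> C, continuous q (RtoC 0) /\ q 0 = l /\ forall x, f x = f 0 + q x * (x - 0).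
Proof.
intros H; exists (fun x => if Ceq_dec_classic x 0 then l else (f x - f 0) / x).
destruct (Ceq_dec_classic 0 0) as [_|n]; [|now elim n].
split; [|split; [reflexivity|]].
- apply continuous_Cmod; intros eps He.
  destruct (H (eps / 2)%R ltac:(lra)) as [delta [Hd HB]]; exists delta; split; [exact Hd|].
  intros x Hx; replace (x - 0) with x in Hx by ring.
  destruct (Ceq_dec_classic 0 0) as [_|n]; [|now elim n].
  destruct (Ceq_dec_classic x 0) as [->|n].
  { replace (l - l) with (RtoC 0) by ring; rewrite Cmod_0; exact He. }
  specialize (HB x n Hx); lra.
- intros x; destruct (Ceq_dec_classic x 0) as [->|n]; [ring | field; exact n].
Qed.

(* The slopes through two points near [0] differ little on the border of the square,
   hence, by the maximum principle, also inside; so the slopes at [0] are Cauchy. *)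
Lemma removable_singularity (f : C -> C) :
  (forall z, in_rect (-1) 1 (-1) 1 z -> continuous f z) ->
  (forall z, in_rect (-1) 1 (-1) 1 z -> z <> 0 -> Cdiff f z) ->
  (forall z, in_rect (-1) 1 (-1) 1 z -> Cmod (f z) <= 1)%R ->
  Cdiff f 0.
Proof.
intros Hc Hf HB.
assert (Hin : forall z, (Cmod z <= 1 / 2)%R -> in_open_rect (-1) 1 (-1) 1 z).
{ intros z Hz; assert (R1 := Re_abs_le z); assert (R2 := Im_abs_le z).
  split; [destruct (Rabs_def2 (Re z) 1) | destruct (Rabs_def2 (Im z) 1)]; lra. }
assert (Hin' : forall z, (Cmod z <= 1 / 2)%R -> in_rect (-1) 1 (-1) 1 z).
{ intros z Hz; destruct (Hin z Hz); split; lra. }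
assert (Slope : forall y, (Cmod y <= 1 / 2)%R -> y <> 0 -> exists q : C -> C,
  (forall x, f x = f y + q x * (x - y)) /\
  (forall z, in_rect (-1) 1 (-1) 1 z -> continuous q z) /\
  (forall z, in_rect (-1) 1 (-1) 1 z -> z <> 0 -> z <> y -> Cdiff q z)).
{ intros y Hy Hy0; destruct (Hf y (Hin' y Hy) Hy0) as [q [Hq Eq]].
  exists q; split; [exact Eq|]; split.
  - intros z Hz; destruct (Ceq_dec_classic z y) as [->|n]; [exact Hq|].
    apply (slope_continuous f q y); auto.
  - intros z Hz Hz0 Hzy; apply (slope_Cdiff f q y); auto. }
assert (Key : forall eps, (0 < eps)%R -> exists delta, (0 < delta <= 1 / 2)%R /\
  forall y y' z : C, (Cmod y < delta)%R -> (Cmod y' < delta)%R -> (Cmod z < delta)%R ->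
    y <> 0 -> y' <> 0 -> z <> 0 -> z <> y -> z <> y' ->
    (Cmod ((f z - f y) / (z - y) - (f z - f y') / (z - y')) <= eps)%R).
{ intros eps He.
  destruct (proj1 (continuous_Cmod f 0) (Hc 0 (Hin' 0 ltac:(rewrite Cmod_0; lra)))
    (eps / 8)%R ltac:(lra)) as [d0 [Hd0 HBc]].
  (* The [1 / 2] keeps [y] and [y'] at distance at least 1/2 from the border. The two summands of
     the slope difference are then at most [4 * (eps / 8)], owing to [eps / 32], and
     [2 * (eps / 8 + eps / 8)], owing to [d0]. *)
  exists (Rmin (1 / 2) (Rmin d0 (eps / 32))); split.
  { split; [repeat apply Rmin_pos; lra | apply Rmin_l]. }
  set (delta := Rmin (1 / 2) (Rmin d0 (eps / 32))).
  assert (D1 : (delta <= 1 / 2)%R) by apply Rmin_l.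
  assert (D2 : (delta <= d0)%R) by (eapply Rle_trans; [apply Rmin_r | apply Rmin_l]).
  assert (D3 : (delta <= eps / 32)%R) by (eapply Rle_trans; [apply Rmin_r | apply Rmin_r]).
  intros y y' z Hy Hy' Hz Hy0 Hy0' Hz0 Hzy Hzy'.
  destruct (Slope y ltac:(lra) Hy0) as [q [Eq [Cq Dq]]].
  destruct (Slope y' ltac:(lra) Hy0') as [q' [Eq' [Cq' Dq']]].
  replace ((f z - f y) / (z - y) - (f z - f y') / (z - y')) with (q z - q' z).
  2: { rewrite (Eq z) at 1; rewrite (Eq' z) at 1; field; split; apply Cminus_neq_0; assumption. }
  (* Its zeros are the points where a slope is only known to be continuous: 0 for both, [y] for [q]
     and [y'] for [q']. The point [z] differs from all three, so [r z] is nonzero. *)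
  set (r := fun x => x * ((x - y) * (x - y'))).
  assert (Dr : forall x, Cdiff r x).
  { intros x; unfold r; repeat apply Cdiff_mult; repeat apply Cdiff_minus;
      try apply Cdiff_id; apply Cdiff_const. }
  apply (maximum_principle (-1) 1 (-1) 1 z (fun x => q x - q' x) r eps (2 * (2 * 4))%R).
  - apply Hin; lra.
  - exact He.
  - intros n x Hx.
    assert (Cn : continuous (fun x => (q x - q' x) ^ n) x).
    { assert (C0 : continuous (fun x => q x - q' x) x) by (apply continuous_Cminus; auto).
      clear - C0; induction n as [|n IH]; [apply (continuous_const (RtoC 1))|].
      apply (continuous_Cmult (fun x => q x - q' x) (fun x => (q x - q' x) ^ n)); assumption. }
    destruct (classic (r x = 0)) as [E|n0].
    + apply Cdiff_mult_vanish; [exact Cn | apply Dr | exact E].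
    + apply Cdiff_mult; [|apply Dr].
      apply Cdiff_pow, Cdiff_minus; [apply Dq | apply Dq']; try exact Hx;
        intros E; apply n0; unfold r; rewrite E; ring.
  - intros x Hx.
    assert (X1 := Cmod_ge_1_border x Hx).
    assert (Xy : forall w, (Cmod w < delta)%R -> (1 / 2 <= Cmod (x - w))%R).
    { intros w Hw; assert (T := Cmod_triangle (x - w) w).
      replace (x - w + w) with x in T by ring; lra. }
    assert (N1 : forall w, (Cmod w < delta)%R -> x - w <> 0).
    { intros w Hw; apply Cmod_gt_0; specialize (Xy w Hw); lra. }
    (* Regrouped so that the small quantities [y - y'] and [f y' - f y] become visible. *)
    replace (q x - q' x) with ((f x - f y) / (x - y) * ((y - y') / (x - y')) + (f y' - f y) / (x - y')).
    2: { replace (q x) with ((f x - f y) / (x - y)) by (rewrite (Eq x) at 1; field; auto).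
         replace (q' x) with ((f x - f y') / (x - y')) by (rewrite (Eq' x) at 1; field; auto).
         field; auto. }
    assert (Bd : forall u w, (Cmod w < delta)%R -> (Cmod (u / (x - w)) <= 2 * Cmod u)%R).
    { intros u w Hw; rewrite Cmod_div by auto.
      specialize (Xy w Hw); assert (U := Cmod_ge_0 u).
      apply Rmult_le_reg_r with (Cmod (x - w)); [lra|].
      unfold Rdiv; rewrite Rmult_assoc, Rinv_l by lra; nra. }
    assert (F2 : forall u v, (Cmod (u - v) <= Cmod u + Cmod v)%R).
    { intros u v; rewrite <- (Cmod_opp v); apply Cmod_triangle. }
    eapply Rle_trans; [apply Cmod_triangle|]; rewrite Cmod_mult.
    assert (B1 := Bd (f x - f y) y Hy); assert (B2 := Bd (y - y') y' Hy');
      assert (B3 := Bd (f y' - f y) y' Hy').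
    assert (B4 := F2 (f x) (f y)); assert (B5 := F2 y y').
    assert (B6 := HB x ltac:(apply Hx)); assert (B7 := HB y (Hin' y ltac:(lra))).
    assert (B8 := HBc y ltac:(replace (y - 0) with y by ring; lra)).
    assert (B9 := HBc y' ltac:(replace (y' - 0) with y' by ring; lra)).
    assert (B10 := F2 (f y' - f 0) (f y - f 0)).
    replace (f y' - f 0 - (f y - f 0)) with (f y' - f y) in B10 by ring.
    assert (Q1 := Cmod_ge_0 ((f x - f y) / (x - y))); assert (Q2 := Cmod_ge_0 ((y - y') / (x - y'))).
    assert (B11 : (Cmod ((f x - f y) / (x - y)) * Cmod ((y - y') / (x - y')) <= 4 * (eps / 8))%R)
      by (apply Rmult_le_compat; lra).
    lra.
  - intros x Hx; unfold r; rewrite !Cmod_mult.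
    assert (X2 : (Cmod x <= 2)%R).
    { eapply Rle_trans; [apply Cmod_le_Re_Im|]; destruct Hx as [[H1 H2] _].
      assert (Rabs (Re x) <= 1)%R by (apply Rabs_le; lra).
      assert (Rabs (Im x) <= 1)%R by (apply Rabs_le; lra); lra. }
    assert (F : forall w, (Cmod w < delta)%R -> (Cmod (x - w) <= 5 / 2)%R).
    { intros w Hw; assert (T := Cmod_triangle x (- w)); rewrite Cmod_opp in T.
      unfold Cminus; lra. }
    assert (G : (Cmod (x - y) * Cmod (x - y') <= 5 / 2 * (5 / 2))%R)
      by (apply Rmult_le_compat; try apply Cmod_ge_0; auto).
    apply Rmult_le_compat; try apply Cmod_ge_0; [apply Rmult_le_pos; apply Cmod_ge_0 | exact X2 | lra].
  - unfold r; repeat apply Cmult_neq_0; try apply Cminus_neq_0; assumption. }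
assert (Hlim : exists l, forall eps : R, (0 < eps)%R -> exists delta : R, (0 < delta)%R /\
    forall x : C, x <> 0 -> (Cmod x < delta)%R -> (Cmod ((f x - f 0) / x - l) <= eps)%R).
{ apply (C_cauchy_limit (fun x => (f x - f 0) / x)).
  intros eps He.
  destruct (Key (eps / 8)%R ltac:(lra)) as [delta [[Hd Hd2] HK]].
  exists delta; split; [exact Hd|].
  (* let [y'] tend to [0] in [Key] *)
  assert (K0 : forall z y : C, z <> 0 -> y <> 0 -> z <> y -> (Cmod z < delta)%R ->
    (Cmod y < delta)%R -> (Cmod ((f z - f y) / (z - y) - (f z - f 0) / z) <= eps / 4)%R).
  { intros z y Hz Hy Hzy Hzd Hyd.
    assert (Cont : continuous (fun w : C => (f z - f w) / (z - w)) (RtoC 0)).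
    { apply continuous_Cdiv; [| |replace (z - 0) with z by ring; exact Hz];
        (apply continuous_Cminus; [apply continuous_const|]).
      - apply Hc, Hin'; rewrite Cmod_0; lra.
      - apply continuous_id. }
    destruct (proj1 (continuous_Cmod _ _) Cont (eps / 8)%R ltac:(lra)) as [e [He0 HC]].
    set (t := (Rmin (Rmin e delta) (Cmod z) / 2)%R).
    assert (Pz := proj1 (Cmod_gt_0 _) Hz).
    assert (T0 : (0 < Rmin (Rmin e delta) (Cmod z))%R) by (repeat apply Rmin_pos; assumption).
    assert (T1 := Rmin_r (Rmin e delta) (Cmod z)).
    assert (T2 := Rle_trans _ _ _ (Rmin_l (Rmin e delta) (Cmod z)) (Rmin_l _ _)).
    assert (T3 := Rle_trans _ _ _ (Rmin_l (Rmin e delta) (Cmod z)) (Rmin_r _ _)).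
    assert (Mt : Cmod (RtoC t) = t) by (rewrite Cmod_R, Rabs_pos_eq; unfold t; lra).
    assert (A := HK y (RtoC t) z Hyd ltac:(rewrite Mt; unfold t; lra) Hzd Hy
      ltac:(apply Cmod_gt_0; rewrite Mt; unfold t; lra) Hz Hzy
      ltac:(intros E; apply (f_equal Cmod) in E; rewrite Mt in E; unfold t in E; lra)).
    assert (B := HC (RtoC t) ltac:(replace (RtoC t - 0) with (RtoC t) by ring; rewrite Mt; unfold t; lra)).
    replace (z - 0) with z in B by ring.
    replace ((f z - f y) / (z - y) - (f z - f 0) / z) with
      (((f z - f y) / (z - y) - (f z - f t) / (z - t)) + ((f z - f t) / (z - t) - (f z - f 0) / z))
      by ring.
    eapply Rle_trans; [apply Cmod_triangle | lra]. }
  intros x x' Hx Hx' Hxd Hxd'.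
  (* An auxiliary point of smaller modulus than [x] and [x'], hence distinct from both. [K0]
     replaces the base point 0 by [t] for each of them and [HK] compares the two slopes at [t]:
     [eps / 4 + eps / 8 + eps / 4]. *)
  set (t := (Rmin (Rmin (Cmod x) (Cmod x')) delta / 2)%R).
  assert (Px := proj1 (Cmod_gt_0 _) Hx); assert (Px' := proj1 (Cmod_gt_0 _) Hx').
  assert (T0 : (0 < Rmin (Rmin (Cmod x) (Cmod x')) delta)%R) by (repeat apply Rmin_pos; assumption).
  assert (T1 := Rmin_r (Rmin (Cmod x) (Cmod x')) delta).
  assert (T2 := Rle_trans _ _ _ (Rmin_l (Rmin (Cmod x) (Cmod x')) delta) (Rmin_l _ _)).
  assert (T3 := Rle_trans _ _ _ (Rmin_l (Rmin (Cmod x) (Cmod x')) delta) (Rmin_r _ _)).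
  assert (Mt : Cmod (RtoC t) = t) by (rewrite Cmod_R, Rabs_pos_eq; unfold t; lra).
  assert (t0 : RtoC t <> 0) by (apply Cmod_gt_0; rewrite Mt; unfold t; lra).
  assert (tx : x <> t) by (intros E; apply (f_equal Cmod) in E; rewrite Mt in E; unfold t in E; lra).
  assert (tx' : x' <> t) by (intros E; apply (f_equal Cmod) in E; rewrite Mt in E; unfold t in E; lra).
  assert (td : (Cmod t < delta)%R) by (rewrite Mt; unfold t; lra).
  assert (A := K0 x t Hx t0 tx Hxd td); assert (A' := K0 x' t Hx' t0 tx' Hxd' td).
  assert (B := HK x x' t Hxd Hxd' td Hx Hx' t0 (not_eq_sym tx) (not_eq_sym tx')).
  rewrite <- Cmod_opp in A.
  replace ((f x - f 0) / x - (f x' - f 0) / x') with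
    (- ((f x - f t) / (x - t) - (f x - f 0) / x) +
     (((f t - f x) / (t - x) - (f t - f x') / (t - x')) +
      ((f x' - f t) / (x' - t) - (f x' - f 0) / x'))).
  2: { field; repeat split; try assumption; apply Cminus_neq_0; auto. }
  eapply Rle_trans; [apply Cmod_triangle|].
  assert (T := Cmod_triangle ((f t - f x) / (t - x) - (f t - f x') / (t - x'))
     ((f x' - f t) / (x' - t) - (f x' - f 0) / x')).
  lra. }
destruct Hlim as [l Hl]; destruct (slope_limit f l Hl) as [q [Hq [_ Eq]]].
exists q; split; assumption.
Qed.

(** * The map tanh(z/4) from the strip onto the unit disc *)

Lemma Cexp_pair (x y : R) : Cexp (x, y) = (exp x * cos y, exp x * sin y)%R.
Proof. unfold Cexp, Re, Im; simpl; apply injective_projections; simpl; ring. Qed.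

Lemma Cexp_plus (z w : C) : Cexp (z + w) = Cexp z * Cexp w.
Proof.
destruct z as [a b], w as [c d]; unfold Cplus; cbn [fst snd].
rewrite !Cexp_pair, exp_plus, cos_plus, sin_plus.
apply injective_projections; simpl; ring.
Qed.

Lemma Cexp_0 : Cexp 0 = 1.
Proof.
unfold RtoC at 1; rewrite Cexp_pair, exp_0, cos_0, sin_0.
apply injective_projections; simpl; ring.
Qed.

Lemma derivable_linear_approx (f : R -> R) (l eps : R) :
  derivable_pt_lim f 0 l -> (0 < eps)%R ->
  exists delta : R, (0 < delta)%R /\ forall h, (Rabs h < delta)%R ->
    (Rabs (f h - f 0%R - l * h) <= eps * Rabs h)%R.
Proof.
intros H He; destruct (H eps He) as [delta Hd].
exists delta; split; [apply cond_pos|]; intros h Hh.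
destruct (Req_dec h 0) as [->|n].
{ replace (f 0%R - f 0%R - l * 0)%R with 0%R by ring; rewrite Rabs_R0; lra. }
specialize (Hd h n Hh); rewrite Rplus_0_l in Hd.
replace (f h - f 0%R - l * h)%R with (((f h - f 0%R) / h - l) * h)%R by (field; exact n).
rewrite Rabs_mult; apply Rmult_le_compat_r; [apply Rabs_pos | lra].
Qed.

(** Assembled from the real derivatives of [exp], [cos] and [sin] at 0; the addition formula carries
    the result to other points. The value [q 0 = 1] is recorded because it makes the zero of
    [disc_map] simple. *)
Lemma Cexp_slope_0 : exists q : C -> C,
  continuous q (RtoC 0) /\ q 0 = 1 /\ forall x, Cexp x = 1 + q x * (x - 0).
Proof.
assert (H := slope_limit Cexp 1); rewrite Cexp_0 in H; apply H; clear H.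
intros eps Heps.
set (e := (eps / 8)%R); assert (He : (0 < e)%R) by (unfold e; lra).
destruct (derivable_linear_approx exp 1 e) as [d1 [Hd1 H1]]; [|exact He|].
{ rewrite <- exp_0; apply derivable_pt_lim_exp. }
destruct (derivable_linear_approx cos 0 e) as [d2 [Hd2 H2]]; [|exact He|].
{ replace 0%R with (- sin 0)%R at 2 by (rewrite sin_0; ring); apply derivable_pt_lim_cos. }
destruct (derivable_linear_approx sin 1 e) as [d3 [Hd3 H3]]; [|exact He|].
{ rewrite <- cos_0; apply derivable_pt_lim_sin. }
rewrite exp_0 in H1; rewrite cos_0 in H2; rewrite sin_0 in H3.
exists (Rmin (Rmin d1 d2) (Rmin (Rmin d3 1) e)); split; [repeat apply Rmin_pos; lra|].
intros x Hx Hxd.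
assert (L1 := Rmin_l (Rmin d1 d2) (Rmin (Rmin d3 1) e)).
assert (L2 := Rmin_r (Rmin d1 d2) (Rmin (Rmin d3 1) e)).
assert (L3 := Rmin_l d1 d2); assert (L4 := Rmin_r d1 d2).
assert (L5 := Rmin_l (Rmin d3 1) e); assert (L6 := Rmin_r (Rmin d3 1) e).
assert (L7 := Rmin_l d3 1); assert (L8 := Rmin_r d3 1).
replace ((Cexp x - 1) / x - 1) with ((Cexp x - 1 - x) / x) by (field; exact Hx).
rewrite Cmod_div by exact Hx.
assert (Px := proj1 (Cmod_gt_0 _) Hx).
apply Rmult_le_reg_r with (Cmod x); [exact Px|].
unfold Rdiv; rewrite Rmult_assoc, Rinv_l, Rmult_1_r by lra.
assert (Ra := Re_abs_le x); assert (Rb := Im_abs_le x).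
eapply Rle_trans; [apply Cmod_le_Re_Im|].
destruct x as [a b]; rewrite Cexp_pair; cbn [Re Im fst snd] in *.
set (m := Cmod (a, b)) in *.

(* The parts of [e^x - 1 - x] are telescoped into first-order remainders of the real functions, plus
   the second-order product [a * b]. They are bounded by 3 and 4 times [e * m], within the [8 * e]
   that makes up [eps]. *)
assert (ER : Re ((exp a * cos b, exp a * sin b)%R - 1 - (a, b)) =
  ((exp a - 1 - 1 * a) * cos b + (1 + a) * (cos b - 1 - 0 * b))%R)
  by (unfold Re; simpl; ring).
assert (EI : Im ((exp a * cos b, exp a * sin b)%R - 1 - (a, b)) =
  ((exp a - 1 - 1 * a) * sin b + (1 + a) * (sin b - 0 - 1 * b) + a * b)%R)
  by (unfold Im; simpl; ring).
rewrite ER, EI.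
specialize (H1 a ltac:(lra)); specialize (H2 b ltac:(lra)); specialize (H3 b ltac:(lra)).
assert (Pa := Rabs_pos a); assert (Pb := Rabs_pos b).
assert (A1 : (Rabs (1 + a) <= 2)%R).
{ eapply Rle_trans; [apply Rabs_triang|]; rewrite Rabs_R1; lra. }
assert (A2 : (Rabs (cos b) <= 1)%R) by (apply Rabs_le, COS_bound).
assert (A3 : (Rabs (sin b) <= 1)%R) by (apply Rabs_le, SIN_bound).
assert (K : forall u v U V, (Rabs u <= U -> Rabs v <= V -> Rabs (u * v) <= U * V)%R).
{ intros u v U V Hu Hv; rewrite Rabs_mult; apply Rmult_le_compat; try apply Rabs_pos; assumption. }
assert (B1 := K _ _ _ _ H1 A2); assert (B2 := K _ _ _ _ A1 H2).
assert (B3 := K _ _ _ _ H1 A3); assert (B4 := K _ _ _ _ A1 H3).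
assert (B5 : (Rabs (a * b) <= m * e)%R) by (apply K; lra).
assert (T1 := Rabs_triang ((exp a - 1 - 1 * a) * cos b) ((1 + a) * (cos b - 1 - 0 * b))).
assert (T2 := Rabs_triang ((exp a - 1 - 1 * a) * sin b + (1 + a) * (sin b - 0 - 1 * b)) (a * b)).
assert (T3 := Rabs_triang ((exp a - 1 - 1 * a) * sin b) ((1 + a) * (sin b - 0 - 1 * b))).
assert (Ha : (e * Rabs a <= e * m)%R) by (apply Rmult_le_compat_l; lra).
assert (Hb : (e * Rabs b <= e * m)%R) by (apply Rmult_le_compat_l; lra).
assert (Hem : (0 < e * m)%R) by (apply Rmult_lt_0_compat; assumption).
replace eps with (8 * e)%R by (unfold e; field); lra.
Qed.

Lemma Cdiff_Cexp (z : C) : Cdiff Cexp z.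
Proof.
destruct Cexp_slope_0 as [q [Hq [_ Eq]]].
apply (Cdiff_ext (fun x => Cexp z * Cexp (x - z))).
{ intros x; rewrite <- Cexp_plus; f_equal; ring. }
apply Cdiff_mult; [apply Cdiff_const|].
apply (Cdiff_comp (fun x => x - z) Cexp).
- apply Cdiff_minus; [apply Cdiff_id | apply Cdiff_const].
- replace (z - z) with (RtoC 0) by ring.
  exists q; split; [exact Hq|]; intros x; rewrite Cexp_0; apply Eq.
Qed.

Lemma Chalf_pair (z : C) : z / 2 = (Re z / 2, Im z / 2)%R.
Proof.
destruct z as [x y]; apply injective_projections; unfold Re, Im; simpl; field.
Qed.

(* tanh(z/4) *)
Definition disc_map (z : C) : C := (Cexp (z / 2) - 1) / (Cexp (z / 2) + 1).

(** Halving brings the imaginary part to where the cosine is positive. So [e^(z/2)] lies in the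
    right half-plane, which [(u - 1) / (u + 1)] sends into the disc. *)
Lemma Re_half_exp_pos (z : C) : strip z -> (0 < Re (Cexp (z / 2)))%R.
Proof.
intros Hz; apply Rabs_def2 in Hz; rewrite Chalf_pair, Cexp_pair; unfold Re at 1; simpl.
apply Rmult_lt_0_compat; [apply exp_pos | apply cos_gt_0; lra].
Qed.

Lemma half_exp_plus_1_neq_0 (z : C) : strip z -> Cexp (z / 2) + 1 <> 0.
Proof.
intros Hz E; apply Re_half_exp_pos in Hz; apply (f_equal Re) in E.
change (Re (Cexp (z / 2)) + 1 = 0)%R in E; lra.
Qed.

Lemma strip_0 : strip 0.
Proof. unfold strip, Im, RtoC; simpl; rewrite Rabs_R0; apply PI_RGT_0. Qed.

Lemma disc_map_0 : disc_map 0 = 0.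
Proof.
unfold disc_map; replace (0 / 2) with (RtoC 0) by field; rewrite Cexp_0; field.
Qed.

Lemma Cmod_sqr (z : C) : (Cmod z ^ 2 = Re z ^ 2 + Im z ^ 2)%R.
Proof. unfold Cmod, Re, Im; rewrite pow2_sqrt; [reflexivity|nra]. Qed.

Lemma Cmod_lt_of_sqr (z w : C) : (Cmod z ^ 2 < Cmod w ^ 2)%R -> (Cmod z < Cmod w)%R.
Proof. intros H; assert (A := Cmod_ge_0 z); assert (B := Cmod_ge_0 w); nra. Qed.

Lemma Cmod_le_of_sqr (z w : C) : (Cmod z ^ 2 <= Cmod w ^ 2)%R -> (Cmod z <= Cmod w)%R.
Proof. intros H; assert (A := Cmod_ge_0 z); assert (B := Cmod_ge_0 w); nra. Qed.

Lemma disc_map_lt_1 (z : C) : strip z -> (Cmod (disc_map z) < 1)%R.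
Proof.
intros Hz; assert (Hn := half_exp_plus_1_neq_0 z Hz); assert (Hp := Re_half_exp_pos z Hz).
unfold disc_map; rewrite Cmod_div by exact Hn.
assert (P := proj1 (Cmod_gt_0 _) Hn).
apply Rmult_lt_reg_r with (Cmod (Cexp (z / 2) + 1)); [exact P|].
unfold Rdiv; rewrite Rmult_assoc, Rinv_l by lra; rewrite Rmult_1_r, Rmult_1_l.
apply Cmod_lt_of_sqr; rewrite !Cmod_sqr.
destruct (Cexp (z / 2)) as [u v]; unfold Re, Im in *; simpl in *; nra.
Qed.

Lemma disc_map_1_minus_neq_0 (z : C) : strip z -> 1 - disc_map z <> 0.
Proof.
intros Hz E; apply disc_map_lt_1 in Hz.
replace (disc_map z) with (RtoC 1) in Hz by (rewrite <- (Cplus_0_r (disc_map z)), <- E; ring).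
rewrite Cmod_1 in Hz; lra.
Qed.

Lemma half_exp_disc_map (z : C) : strip z ->
  Cexp (z / 2) = (1 + disc_map z) / (1 - disc_map z).
Proof.
intros Hz; assert (Hn := half_exp_plus_1_neq_0 z Hz).
unfold disc_map; field; split; [exact Hn|].
replace (Cexp (z / 2) + 1 - (Cexp (z / 2) - 1)) with (RtoC 2) by ring.
intros E; apply (f_equal fst) in E; simpl in E; lra.
Qed.

Lemma disc_map_real (x : R) : Im (disc_map (RtoC x)) = 0%R.
Proof.
assert (E : RtoC x / 2 = (x / 2, 0)%R)
  by (apply injective_projections; simpl; field).
unfold disc_map; rewrite E, Cexp_pair, cos_0, sin_0.
unfold Im; simpl; unfold Rdiv; ring.
Qed.

Lemma disc_map_neq_0 (z : C) : strip z -> z <> 0 -> disc_map z <> 0.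
Proof.
intros Hz Hz0 E; apply Hz0.
assert (Hn := half_exp_plus_1_neq_0 z Hz).
assert (E1 : Cexp (z / 2) = 1).
{ rewrite (half_exp_disc_map z Hz), E; field. }
apply Rabs_def2 in Hz.
rewrite Chalf_pair, Cexp_pair in E1.
assert (Er := f_equal fst E1); assert (Ei := f_equal snd E1); simpl in Er, Ei.
assert (Hc : (0 < cos (Im z / 2))%R) by (apply cos_gt_0; lra).
assert (P := exp_pos (Re z / 2)).
assert (Hs : sin (Im z / 2) = 0%R) by (apply Rmult_integral in Ei; lra).
assert (Hy : Im z = 0%R).
{ destruct (Rtotal_order (Im z) 0) as [H|[H|H]]; [|exact H|].
  - assert (0 < sin (- (Im z / 2)))%R by (apply sin_gt_0; lra); rewrite sin_neg in *; lra.
  - assert (0 < sin (Im z / 2))%R by (apply sin_gt_0; lra); lra. }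
rewrite Hy in Er; replace (0 / 2)%R with 0%R in Er by field; rewrite cos_0, Rmult_1_r in Er.
rewrite <- exp_0 in Er; apply exp_inv in Er.
apply injective_projections; simpl; [unfold Re in Er; lra | exact Hy].
Qed.

Lemma Cdiff_half_exp (z : C) : Cdiff (fun x => Cexp (x / 2)) z.
Proof.
apply (Cdiff_comp (fun x => x / 2) Cexp); [|apply Cdiff_Cexp].
apply Cdiff_mult; [apply Cdiff_id | apply Cdiff_const].
Qed.

Lemma Cdiff_disc_map (z : C) : strip z -> Cdiff disc_map z.
Proof.
intros Hz; apply Cdiff_div; [| |apply half_exp_plus_1_neq_0, Hz];
  [apply Cdiff_minus | apply Cdiff_plus]; try apply Cdiff_half_exp; apply Cdiff_const.
Qed.

(** The Schur step divides by [disc_map]. Its zero at 0 is simple and is the only one in the strip,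
    so the division becomes a quotient of two slopes whose denominator never vanishes. *)
Lemma disc_map_slope_0 : exists s : C -> C, continuous s (RtoC 0) /\
  (forall x, disc_map x = disc_map 0 + s x * (x - 0)) /\
  (forall z, strip z -> s z <> 0).
Proof.
destruct Cexp_slope_0 as [q [Hq [Hq0 Eq]]].
set (s := fun x => q (x / 2) / 2 / (Cexp (x / 2) + 1)).
assert (H2 : RtoC 2 <> 0) by (intros F; apply (f_equal fst) in F; simpl in F; lra).
assert (E : forall x, disc_map x = disc_map 0 + s x * (x - 0)).
{ intros x; rewrite disc_map_0; unfold disc_map, s; rewrite (Eq (x / 2)) at 1.
  unfold Cdiv; ring. }
assert (h0 : 0 / 2 = 0) by (field; exact H2).
exists s; split; [|split; [exact E|]].
- unfold s; apply continuous_Cdiv.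
  + apply continuous_Cmult; [|apply continuous_const].
    apply (continuous_comp (fun x : C => x / 2) q); [|rewrite h0; exact Hq].
    apply continuous_Cmult; [apply continuous_id | apply continuous_const].
  + apply continuous_Cplus; [|apply continuous_const].
    apply Cdiff_continuous, Cdiff_half_exp.
  + apply half_exp_plus_1_neq_0, strip_0.
- intros z Hz; destruct (Ceq_dec_classic z 0) as [->|n].
  + unfold s; rewrite h0, Hq0; unfold Cdiv.
    repeat apply Cmult_neq_0; try apply C1_nz.
    * intros F; apply (f_equal fst) in F; simpl in F; lra.
    * rewrite Cexp_0; intros F; apply (f_equal fst) in F; simpl in F; lra.
  + intros F; apply (disc_map_neq_0 z Hz n); rewrite E, F, disc_map_0; ring.
Qed.

(** Provides the borders for the Schwarz lemma: where [disc_map] has modulus close to 1, a bound on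
    [disc_map z * h' z] becomes almost the same bound on [h' z]. *)
Lemma disc_map_border (p : C) (eta : R) : strip p -> (0 < eta < 1)%R ->
  exists a b c d : R, in_open_rect a b c d p /\
    (forall z, in_rect a b c d z -> strip z) /\
    (forall z, on_border a b c d z -> 1 - eta <= Cmod (disc_map z))%R.
Proof.
intros Hp He; assert (HPI := PI_RGT_0).
(* The width is chosen for the vertical sides, to make [eta * exp (A / 2)] at least 4. The margin
   [t] is chosen for the horizontal ones, where [cos (Im z / 2) = sin (t / 2)] is at most [eta / 2].
   The remaining terms put [p] inside. *)
set (A := (Rabs (Re p) + 8 / eta + 1)%R).
set (t := Rmin eta ((PI - Rabs (Im p)) / 2)%R).
assert (Ht0 : (0 < t)%R) by (unfold strip in Hp; apply Rmin_pos; lra).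
assert (Ht1 : (t <= eta)%R) by apply Rmin_l.
assert (Ht2 : (t <= (PI - Rabs (Im p)) / 2)%R) by apply Rmin_r.
assert (H8 : (0 < 8 / eta)%R) by (apply Rdiv_lt_0_compat; lra).
assert (Hs : forall z, in_rect (- A) A (- (PI - t)) (PI - t) z -> strip z).
{ intros z [_ Hz]; unfold strip; apply Rle_lt_trans with (PI - t)%R; [apply Rabs_le; lra | lra]. }
exists (- A)%R, A, (- (PI - t))%R, (PI - t)%R.
unfold strip in Hp.
assert (Q1 := Rle_abs (Re p)); assert (Q2 := Rle_abs (Im p)).
assert (Q3 := Rle_abs (- Re p)); assert (Q4 := Rle_abs (- Im p)).
rewrite Rabs_Ropp in Q3, Q4.
split; [split; unfold A; lra|]; split; [exact Hs|].
intros z [Hz Hb]; assert (Sz := Hs z Hz).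
assert (Hn := half_exp_plus_1_neq_0 z Sz); assert (Hpos := Re_half_exp_pos z Sz).
assert (P := proj1 (Cmod_gt_0 _) Hn).
assert (Hlt := disc_map_lt_1 z Sz); assert (Hge := Cmod_ge_0 (disc_map z)).
enough (H : (1 - eta <= Cmod (disc_map z) ^ 2)%R) by nra.
unfold disc_map; rewrite Cmod_div by exact Hn.
assert (P2 : (0 < Cmod (Cexp (z / 2) + 1) ^ 2)%R) by (apply pow_lt, P).
apply Rmult_le_reg_r with (Cmod (Cexp (z / 2) + 1) ^ 2)%R; [exact P2|].
replace ((Cmod (Cexp (z / 2) - 1) / Cmod (Cexp (z / 2) + 1)) ^ 2 * Cmod (Cexp (z / 2) + 1) ^ 2)%R
  with (Cmod (Cexp (z / 2) - 1) ^ 2)%R by (field; lra).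
clear - Hb Hpos Ht0 Ht1 He Hz H8 Ht2 HPI.
rewrite !Cmod_sqr; rewrite Chalf_pair, Cexp_pair in *.
set (r := exp (Re z / 2)) in *; set (y := (Im z / 2)%R) in *.
unfold Re, Im in Hpos |- *; simpl in Hpos |- *; fold (Re z) in *.
assert (Hr : (0 < r)%R) by apply exp_pos.
assert (Hsc : (sin y ^ 2 + cos y ^ 2 = 1)%R) by (rewrite <- (sin2_cos2 y); unfold Rsqr; ring).
assert (Hc0 : (0 < cos y)%R) by nra.
assert (Hc1 : (cos y <= 1)%R) by apply COS_bound.
(* The squared moduli of [e^(z/2) - 1] and [e^(z/2) + 1] are [r ^ 2 + 1] minus and plus
   [2 * (r * cos y)]. The cross term is relatively small because [r] is extreme on the vertical
   sides and [cos y] is small on the horizontal ones. *)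
enough (K : (4 * (r * cos y) <= eta * (r ^ 2 + 1))%R) by nra.
assert (Hexp : forall x, (8 / eta <= x -> 4 <= eta * exp (x / 2))%R).
{ intros x Hx; assert (X := exp_ineq1_le (x / 2)).
  apply (Rmult_le_compat_l eta) in Hx; [|lra].
  replace (eta * (8 / eta))%R with 8%R in Hx by (field; lra); nra. }
assert (Hcos : (Im z = PI - t \/ Im z = - (PI - t) -> 2 * cos y <= eta)%R).
{ intros H.
  assert (E : cos y = sin (t / 2)).
  { rewrite <- cos_shift; destruct H as [H|H].
    - f_equal; unfold y; rewrite H; field.
    - rewrite <- cos_neg; f_equal; unfold y; rewrite H; field. }
  assert (S := sin_lt_x (t / 2)); rewrite E; lra. }
destruct Hb as [Hb|[Hb|[Hb|Hb]]].
- assert (X := Hexp A ltac:(unfold A; assert (Q := Rabs_pos (Re p)); lra)).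
  assert (Er : (r * exp (A / 2) = 1)%R).
  { unfold r; rewrite <- exp_plus, Hb; replace (- A / 2 + A / 2)%R with 0%R by field; apply exp_0. }
  assert (4 * r <= eta)%R by nra; nra.
- assert (X := Hexp A ltac:(unfold A; assert (Q := Rabs_pos (Re p)); lra)).
  unfold r in *; rewrite Hb in *; nra.
- assert (X := Rmult_le_compat_l r _ _ ltac:(lra) (Hcos (or_intror Hb))).
  assert (Y : (0 <= eta * (r - 1) ^ 2)%R) by (apply Rmult_le_pos; [lra | apply pow2_ge_0]); nra.
- assert (X := Rmult_le_compat_l r _ _ ltac:(lra) (Hcos (or_introl Hb))).
  assert (Y : (0 <= eta * (r - 1) ^ 2)%R) by (apply Rmult_le_pos; [lra | apply pow2_ge_0]); nra.
Qed.

(** * The real Schur class *)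

Definition real_schur (h : C -> C) : Prop :=
  (forall z, strip z -> Cdiff h z) /\
  (forall z, strip z -> (Cmod (h z) <= 1)%R) /\
  (forall x : R, Im (h (RtoC x)) = 0%R).

Lemma real_schur_0 (h : C -> C) : real_schur h ->
  h 0 = RtoC (Re (h 0)) /\ (Rabs (Re (h 0)) <= 1)%R.
Proof.
intros [_ [Hb Hr]].
assert (E : h 0 = RtoC (Re (h 0))) by (apply injective_projections; [reflexivity | apply Hr]).
split; [exact E|].
rewrite <- Cmod_R, <- E; apply Hb, strip_0.
Qed.

Lemma one_minus_real_mult_neq_0 (x : R) (u : C) :
  (Rabs x <= 1)%R -> (Cmod u < 1)%R -> 1 - x * u <> 0.
Proof.
intros Hx Hu E.
assert (E1 : RtoC 1 = x * u) by (rewrite <- (Cplus_0_r (x * u)), <- E; ring).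
apply (f_equal Cmod) in E1; rewrite Cmod_1, Cmod_mult, Cmod_R in E1.
assert (A := Cmod_ge_0 u); assert (B := Rabs_pos x); nra.
Qed.

(** The squared moduli differ by [(1 - x ^ 2) * (1 - Cmod u ^ 2)]. *)
Lemma real_moebius_bound (x : R) (u : C) :
  (Rabs x <= 1)%R -> (Cmod u <= 1)%R -> (Cmod (u - x) <= Cmod (1 - x * u))%R.
Proof.
intros Hx Hu; apply Cmod_le_of_sqr.
assert (Hu2 : (Cmod u ^ 2 <= 1)%R) by (assert (A := Cmod_ge_0 u); nra).
assert (Hx2 : (x ^ 2 <= 1)%R) by (apply Rabs_le_between in Hx; nra).
rewrite Cmod_sqr in Hu2; rewrite !Cmod_sqr; destruct u as [a b]; unfold Re, Im in *; simpl in *; nra.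
Qed.

(** Solving for the new function gives [disc_map z * h' z = (eta - h z) / (1 - eta * h z)]. The
    right side vanishes at 0 and is bounded by 1; the maximum principle then frees the bound from
    the factor [disc_map z]. *)
Lemma schwarz_pick_step (h : C -> C) (eta : R) :
  real_schur h -> h 0 = RtoC eta -> (Rabs eta < 1)%R ->
  exists h' : C -> C, real_schur h' /\
    forall z, strip z -> h z * (1 - eta * (disc_map z * h' z)) = eta - disc_map z * h' z.
Proof.
intros [Hd [Hb Hr]] H0 Heta.
destruct (Hd 0 strip_0) as [q [Hq Eq]].
destruct disc_map_slope_0 as [s [Hs [Es Ns]]]; rewrite disc_map_0 in Es.
assert (Nh : forall z, strip z -> 1 - eta * h z <> 0).
{ intros z Hz E.
  assert (E1 : RtoC 1 = eta * h z) by (rewrite <- (Cplus_0_r (eta * h z)), <- E; ring).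
  apply (f_equal Cmod) in E1; rewrite Cmod_1, Cmod_mult, Cmod_R in E1.
  assert (A := Hb z Hz); assert (B := Rabs_pos eta); nra. }
(* A quotient of the slopes at 0 of [h] and [disc_map]: the common factor [z] is already cancelled,
   which gives [h'] the right value at 0. *)
set (h' := fun z => - q z / (s z * (1 - eta * h z))).
assert (ET : forall z, strip z -> disc_map z * h' z = - (h z - eta) / (1 - eta * h z)).
{ intros z Hz; rewrite (Es z), (Eq z) at 1; rewrite H0; unfold h'.
  field; split; [apply Nh, Hz | apply Ns, Hz]. }
assert (Eh : forall z, strip z -> h z * (1 - eta * (disc_map z * h' z)) = eta - disc_map z * h' z).
{ intros z Hz; rewrite (ET z Hz); field; apply Nh, Hz. }
assert (Dden : forall z, strip z -> Cdiff (fun z => 1 - eta * h z) z).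
{ intros z Hz; apply Cdiff_minus; [apply Cdiff_const|].
  apply Cdiff_mult; [apply Cdiff_const | apply Hd, Hz]. }
assert (D1 : forall z, strip z -> z <> 0 -> Cdiff h' z).
{ intros z Hz n; apply Cdiff_div.
  - apply Cdiff_opp, (slope_Cdiff h q 0); try assumption; apply Hd, Hz.
  - apply Cdiff_mult; [|apply Dden, Hz].
    apply (slope_Cdiff disc_map s 0); try assumption; [|apply Cdiff_disc_map, Hz].
    rewrite disc_map_0; exact Es.
  - apply Cmult_neq_0; [apply Ns, Hz | apply Nh, Hz]. }
assert (C1 : forall z, strip z -> continuous h' z).
{ intros z Hz; destruct (Ceq_dec_classic z 0) as [->|n]; [|apply Cdiff_continuous, D1; assumption].
  apply continuous_Cdiv.
  - apply continuous_Copp, Hq.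
  - apply continuous_Cmult; [exact Hs | apply Cdiff_continuous, Dden, strip_0].
  - apply Cmult_neq_0; [apply Ns, Hz | apply Nh, Hz]. }
assert (BT : forall z, strip z -> (Cmod (disc_map z) * Cmod (h' z) <= 1)%R).
{ intros z Hz; rewrite <- Cmod_mult, (ET z Hz).
  assert (N := Nh z Hz); rewrite Cmod_div, Cmod_opp by exact N.
  assert (P := proj1 (Cmod_gt_0 _) N).
  apply Rmult_le_reg_r with (Cmod (1 - eta * h z)); [exact P|].
  unfold Rdiv; rewrite Rmult_assoc, Rinv_l by lra; rewrite Rmult_1_r, Rmult_1_l.
  apply real_moebius_bound; [lra | apply Hb, Hz]. }
(* The factor [z] handed to the maximum principle absorbs the point 0, where [h'] is so far only
   continuous, and therefore confines the argument to [z <> 0]; the point 0 itself follows by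
   continuity. The border bound [/ (1 - e)] yields 1 as [e] tends to 0. *)
assert (B1 : forall z, strip z -> z <> 0 -> (Cmod (h' z) <= 1)%R).
{ intros z Hz n.
  apply (Rle_plus_eps_le _ _ (Cmod (h' z))); [apply Cmod_ge_0|].
  exists (/ 2)%R; split; [lra|]; intros e He He2.
  destruct (disc_map_border z e Hz ltac:(lra)) as [a [b [c [d [Hin [Hst Hbd]]]]]].
  assert (M : (Cmod (h' z) <= / (1 - e))%R).
  { apply (maximum_principle a b c d z h' (fun z => z) (/ (1 - e))
      (Rabs a + Rabs b + (Rabs c + Rabs d))%R); try assumption.
    - apply Rinv_0_lt_compat; lra.
    - intros k x Hx; assert (Sx := Hst x Hx).
      destruct (Ceq_dec_classic x 0) as [->|nx].
      + apply Cdiff_mult_vanish; [|apply Cdiff_id | reflexivity].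
        clear - C1 Sx; induction k as [|k IH]; [apply (continuous_const (RtoC 1))|].
        apply (continuous_Cmult h' (fun x => h' x ^ k)); [apply C1, Sx | exact IH].
      + apply Cdiff_mult; [|apply Cdiff_id]; apply Cdiff_pow, D1; assumption.
    - intros x Hx; assert (T := Hbd x Hx); assert (T2 := BT x (Hst x (proj1 Hx))).
      assert (T3 := Cmod_ge_0 (h' x)).
      apply Rmult_le_reg_l with (1 - e)%R; [lra|]; rewrite Rinv_r by lra; nra.
    - intros x [[Hx Hy] _]; eapply Rle_trans; [apply Cmod_le_Re_Im|].
      assert (A1 := Rle_abs a); assert (A2 := Rle_abs (- a)); rewrite Rabs_Ropp in A2.
      assert (A3 := Rle_abs b); assert (A4 := Rle_abs (- b)); rewrite Rabs_Ropp in A4.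
      assert (A5 := Rle_abs c); assert (A6 := Rle_abs (- c)); rewrite Rabs_Ropp in A6.
      assert (A7 := Rle_abs d); assert (A8 := Rle_abs (- d)); rewrite Rabs_Ropp in A8.
      apply Rplus_le_compat; apply Rabs_le; lra. }
  apply (Rmult_le_compat_l (1 - e)) in M; [|lra]; rewrite Rinv_r in M by lra; lra. }
assert (Dist0 : forall delta, (0 < delta)%R -> exists x : R, RtoC x <> 0 /\ (Cmod (RtoC x - 0) < delta)%R).
{ intros delta Hdl; exists (delta / 2)%R; replace (RtoC (delta / 2) - 0) with (RtoC (delta / 2)) by ring.
  assert (E : Cmod (delta / 2)%R = (delta / 2)%R) by (rewrite Cmod_R, Rabs_pos_eq; lra).
  split; [apply Cmod_gt_0|]; rewrite E; lra. }
assert (Sreal : forall x : R, strip x).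
{ intros x; unfold strip, Im; simpl; rewrite Rabs_R0; apply PI_RGT_0. }
assert (B2 : forall z, strip z -> (Cmod (h' z) <= 1)%R).
{ intros z Hz; destruct (Ceq_dec_classic z 0) as [->|n]; [|apply B1; assumption].
  apply (Rle_plus_eps_le _ _ 1); [lra|]; exists 1%R; split; [lra|]; intros e He _.
  destruct (proj1 (continuous_Cmod _ _) (C1 0 Hz) e He) as [delta [Hdl HC]].
  destruct (Dist0 delta Hdl) as [x [Hx0 Hx]]; specialize (HC x Hx).
  assert (T := Cmod_triangle (h' x) (- (h' x - h' 0))); rewrite Cmod_opp in T.
  replace (h' x + - (h' x - h' 0)) with (h' 0) in T by ring.
  assert (U := B1 x (Sreal x) Hx0); lra. }
exists h'; split; [split; [|split]|exact Eh].
- intros z Hz; destruct (Ceq_dec_classic z 0) as [->|n]; [|apply D1; assumption].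
  assert (Sq : forall z, in_rect (-1) 1 (-1) 1 z -> strip z).
  { intros w [_ Hw]; unfold strip; assert (P := PI2_1).
    apply Rle_lt_trans with 1%R; [apply Rabs_le; lra | lra]. }
  apply removable_singularity; auto.
- exact B2.
- assert (R1 : forall x : R, RtoC x <> 0 -> Im (h' x) = 0%R).
  { intros x Hx.
    assert (E : h' x = - (h x - eta) / (1 - eta * h x) / disc_map x).
    { rewrite <- ET by apply Sreal; field; apply disc_map_neq_0; [apply Sreal | exact Hx]. }
    assert (F1 : h x = RtoC (Re (h x))) by (apply injective_projections; [reflexivity | apply Hr]).
    assert (F2 : disc_map x = RtoC (Re (disc_map x)))
      by (apply injective_projections; [reflexivity | apply disc_map_real]).
    rewrite E, F1, F2; unfold Im; simpl; unfold Rdiv; ring. }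
  intros x; destruct (Ceq_dec_classic x 0) as [->|n]; [|apply R1, n].
  apply NNPP; intros Hne; assert (P := Rabs_pos_lt _ Hne).
  destruct (proj1 (continuous_Cmod _ _) (C1 0 strip_0) _ P) as [delta [Hdl HC]].
  destruct (Dist0 delta Hdl) as [y [Hy0 Hy]]; specialize (HC y Hy).
  assert (T := Im_abs_le (h' y - h' 0)).
  change (Im (h' y - h' 0)) with (Im (h' y) - Im (h' 0))%R in T.
  rewrite (R1 y Hy0), Rminus_0_l, Rabs_Ropp in T; lra.
Qed.

(** The Schwarz inequality for the scaled functions tends to [A <= r * A], where [A] is the modulus
    of [h z - eta] and [r < 1] that of [disc_map z]; hence [A = 0]. *)
Lemma real_schur_extremal (h : C -> C) (eta : R) :
  real_schur h -> h 0 = RtoC eta -> (Rabs eta = 1)%R ->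
  forall z, strip z -> h z = RtoC eta.
Proof.
intros [Hd [Hb Hr]] H0 Heta z Hz.
assert (Heta2 : (eta * eta = 1)%R).
{ assert (T := Rsqr_abs eta); rewrite Heta in T; unfold Rsqr in T; lra. }
set (r := Cmod (disc_map z)); set (A := Cmod (h z - eta)).
assert (Hr1 : (r < 1)%R) by apply disc_map_lt_1, Hz.
assert (Hr0 : (0 <= r)%R) by apply Cmod_ge_0.
assert (HA : (0 <= A)%R) by apply Cmod_ge_0.
enough (K : ((1 - r) * A <= 0)%R).
{ assert (A0 : A = 0%R) by nra.
  apply Cmod_eq_0 in A0; rewrite <- (Cplus_0_r (RtoC eta)), <- A0; ring. }
(* With [t = 1 - e], the inequality [t * A <= r * (A + (1 - t * t))] leaves an excess of at most
   [e * A + 2 * e]. *)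
apply (Rle_plus_eps_le _ _ (A + 2)); [lra|].
exists (/ 2)%R; split; [lra|]; intros e He He2.
(* Scaling [h] by [t < 1] leads back to the non-extremal case. *)
set (t := (1 - e)%R).
destruct (schwarz_pick_step (fun x => t * h x) (t * eta)) as [h' [[_ [Hb' _]] E]].
- split; [|split].
  + intros x Hx; apply Cdiff_mult; [apply Cdiff_const | apply Hd, Hx].
  + intros x Hx; rewrite Cmod_mult, Cmod_R.
    assert (B := Hb x Hx); assert (B' := Cmod_ge_0 (h x)).
    rewrite Rabs_pos_eq by (unfold t; lra); unfold t; nra.
  + intros x; rewrite im_scal_l, Hr; ring.
- rewrite H0, RtoC_mult; reflexivity.
- rewrite Rabs_mult, Heta, Rabs_pos_eq by (unfold t; lra); unfold t; lra.
- specialize (E z Hz); rewrite RtoC_mult in E.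
  assert (E2 : t * (h z - eta) = - (disc_map z * h' z) * (1 - t * t * eta * h z)).
  { replace (t * (h z - eta)) with (t * h z * (1 - t * eta * (disc_map z * h' z)) - t * eta
       + t * h z * (t * eta * (disc_map z * h' z))) by ring.
    rewrite E; ring. }
  assert (E3 : (t * A <= r * Cmod (1 - t * t * eta * h z))%R).
  { unfold A, r; rewrite <- (Rabs_pos_eq t) at 1 by (unfold t; lra).
    rewrite <- Cmod_R, <- Cmod_mult, E2, Cmod_mult, Cmod_opp, Cmod_mult.
    apply Rmult_le_compat_r; [apply Cmod_ge_0|].
    assert (B := Hb' z Hz); fold r; nra. }
  assert (E4 : (Cmod (1 - t * t * eta * h z) <= A + (1 - t * t))%R).
  { replace (1 - t * t * eta * h z) with (- eta * (h z - eta) + RtoC (1 - t * t) * (eta * h z)).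
    2: { transitivity (eta * eta - t * t * eta * h z).
         - rewrite RtoC_minus, RtoC_mult; ring.
         - rewrite <- (RtoC_mult eta eta), Heta2; reflexivity. }
    eapply Rle_trans; [apply Cmod_triangle|].
    rewrite !Cmod_mult, Cmod_opp, !Cmod_R, Heta, Rmult_1_l.
    assert (B := Hb z Hz).
    assert (0 <= 1 - t * t)%R by (unfold t; nra).
    rewrite Rabs_pos_eq by assumption; fold A; nra. }
  assert (E5 : (t * A <= r * (A + (1 - t * t)))%R).
  { eapply Rle_trans; [exact E3|]; apply Rmult_le_compat_l; assumption. }
  assert (E6 : (r * (1 - t * t) <= 2 * e)%R) by (unfold t; nra).
  unfold t in *; nra.
Qed.

(** If the value at 0 is 1 or -1, the function is constant and any [h'] satisfies the recursion; 0
    is chosen. The corresponding g is then 0 or 1, which makes a partial numerator vanish. *)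
Lemma schur_step (h : C -> C) : real_schur h ->
  exists h' : C -> C, real_schur h' /\
    forall z, strip z ->
      h z * (1 - Re (h 0) * (disc_map z * h' z)) = Re (h 0) - disc_map z * h' z.
Proof.
intros H; destruct (real_schur_0 h H) as [E Hle].
destruct (Req_dec (Rabs (Re (h 0))) 1) as [H1|H1].
- exists (fun _ => 0); split.
  + split; [|split].
    * intros; apply Cdiff_const.
    * intros; rewrite Cmod_0; lra.
    * reflexivity.
  + intros z Hz; rewrite (real_schur_extremal h (Re (h 0)) H E H1 z Hz); ring.
- apply schwarz_pick_step; try assumption; lra.
Qed.

(** * Convergence of the g-fraction *)

Lemma one_plus_neq_0 (u : C) : (Cmod u < 1)%R -> 1 + u <> 0.
Proof.
intros Hu; replace (1 + u) with (1 - (- (1))%R * u) by (unfold Cminus; rewrite RtoC_opp; ring).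
apply one_minus_real_mult_neq_0; [rewrite Rabs_left; lra | exact Hu].
Qed.

Lemma one_minus_neq_0 (u : C) : (Cmod u < 1)%R -> 1 - u <> 0.
Proof.
intros Hu; replace (1 - u) with (1 - 1%R * u) by ring.
apply one_minus_real_mult_neq_0; [rewrite Rabs_R1; lra | exact Hu].
Qed.

Definition moebius (eta : R) (x : C) : C := (eta - x) / (1 - eta * x).

Lemma moebius_bound (eta : R) (x : C) :
  (Rabs eta <= 1)%R -> (Cmod x < 1)%R -> (Cmod (moebius eta x) <= 1)%R.
Proof.
intros He Hx; assert (N := one_minus_real_mult_neq_0 eta x He Hx).
unfold moebius; rewrite Cmod_div by exact N.
assert (P := proj1 (Cmod_gt_0 _) N).
apply Rmult_le_reg_r with (Cmod (1 - eta * x)); [exact P|].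
unfold Rdiv; rewrite Rmult_assoc, Rinv_l by lra; rewrite Rmult_1_r, Rmult_1_l.
rewrite <- (Cmod_opp (eta - x)); replace (- (eta - x)) with (x - eta) by ring.
apply real_moebius_bound; [exact He | lra].
Qed.

(* For K = sinh(d)^2 this bounds the hyperbolic distance of [x] and [y] by [d]; clearing
   the denominators keeps it meaningful on the unit circle. *)
Definition hyp_close (K : R) (x y : C) : Prop :=
  (Cmod (x - y) ^ 2 <= K * ((1 - Cmod x ^ 2) * (1 - Cmod y ^ 2)))%R.

Lemma Cmod_moebius_defect (eta : R) (x : C) :
  (Rabs eta <= 1)%R -> (Cmod x < 1)%R ->
  (1 - Cmod (moebius eta x) ^ 2 =
    (1 - eta ^ 2) * (1 - Cmod x ^ 2) / Cmod (1 - eta * x) ^ 2)%R.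
Proof.
intros He Hx; assert (N := one_minus_real_mult_neq_0 eta x He Hx).
unfold moebius; rewrite Cmod_div by exact N.
assert (P := proj1 (Cmod_gt_0 _) N).
assert (E : (Cmod (1 - eta * x) ^ 2 - Cmod (eta - x) ^ 2 = (1 - eta ^ 2) * (1 - Cmod x ^ 2))%R).
{ rewrite !Cmod_sqr; destruct x; unfold Re, Im; simpl; ring. }
rewrite <- E; field; lra.
Qed.

(** Both sides of the inequality are multiplied by the same factor, [(eta ^ 2 - 1) ^ 2] over the
    squared moduli of the two denominators. It is 0 when [eta] is 1 or -1, so degenerate parameters
    are covered. *)
Lemma hyp_close_moebius (K eta : R) (x y : C) :
  (Rabs eta <= 1)%R -> (Cmod x < 1)%R -> (Cmod y < 1)%R ->
  hyp_close K x y -> hyp_close K (moebius eta x) (moebius eta y).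
Proof.
intros He Hx Hy H; unfold hyp_close in *.
assert (Nx := one_minus_real_mult_neq_0 eta x He Hx).
assert (Ny := one_minus_real_mult_neq_0 eta y He Hy).
assert (Px := proj1 (Cmod_gt_0 _) Nx); assert (Py := proj1 (Cmod_gt_0 _) Ny).
rewrite !Cmod_moebius_defect by assumption.
assert (E : moebius eta x - moebius eta y =
  RtoC (eta ^ 2 - 1) * (x - y) / ((1 - eta * x) * (1 - eta * y))).
{ unfold moebius; rewrite RtoC_minus, RtoC_pow; field; split; assumption. }
rewrite E, Cmod_div, !Cmod_mult, Cmod_R by (apply Cmult_neq_0; assumption).
set (a := Cmod (1 - eta * x)) in *; set (b := Cmod (1 - eta * y)) in *.
replace ((Rabs (eta ^ 2 - 1) * Cmod (x - y) / (a * b)) ^ 2)%R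
  with ((Rabs (eta ^ 2 - 1)) ^ 2 / (a * b) ^ 2 * Cmod (x - y) ^ 2)%R by (field; lra).
rewrite <- Rsqr_pow2, <- Rsqr_abs, Rsqr_pow2.
replace (K * ((1 - eta ^ 2) * (1 - Cmod x ^ 2) / a ^ 2 * ((1 - eta ^ 2) * (1 - Cmod y ^ 2) / b ^ 2)))%R
  with ((eta ^ 2 - 1) ^ 2 / (a * b) ^ 2 * (K * ((1 - Cmod x ^ 2) * (1 - Cmod y ^ 2))))%R
  by (field; lra).
apply Rmult_le_compat_l; [|exact H].
apply Rmult_le_pos; [apply pow2_ge_0|].
apply Rlt_le, Rinv_0_lt_compat, pow_lt, Rmult_lt_0_compat; assumption.
Qed.

Lemma hyp_close_scale (K : R) (T x y : C) :
  (0 <= K)%R -> (Cmod T <= 1)%R -> (Cmod x <= 1)%R -> (Cmod y <= 1)%R ->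
  hyp_close K x y -> hyp_close (K * Cmod T ^ 2) (T * x) (T * y).
Proof.
intros HK HT Hx Hy H; unfold hyp_close in *.
replace (T * x - T * y) with (T * (x - y)) by ring.
rewrite !Cmod_mult, !Rpow_mult_distr.
assert (T0 := Cmod_ge_0 T); assert (x0 := Cmod_ge_0 x); assert (y0 := Cmod_ge_0 y).
set (t := (Cmod T ^ 2)%R); assert (t0 : (0 <= t <= 1)%R) by (unfold t; nra).
assert (X : (0 <= 1 - Cmod x ^ 2 <= 1 - t * Cmod x ^ 2)%R) by nra.
assert (Y : (0 <= 1 - Cmod y ^ 2 <= 1 - t * Cmod y ^ 2)%R) by nra.
replace (K * t * ((1 - t * Cmod x ^ 2) * (1 - t * Cmod y ^ 2)))%R
  with (t * (K * ((1 - t * Cmod x ^ 2) * (1 - t * Cmod y ^ 2))))%R by ring.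
apply Rmult_le_compat_l; [lra|].
eapply Rle_trans; [exact H|].
apply Rmult_le_compat_l; [exact HK|]; apply Rmult_le_compat; lra.
Qed.

(* [T h_k] for the function whose Schur parameters are [eta k .. eta (k+n-1)] followed by
   the constant 1. *)
Fixpoint schur_approx (eta : nat -> R) (T : C) (n k : nat) : C :=
  match n with
  | O => T
  | S m => T * moebius (eta k) (schur_approx eta T m (S k))
  end.

Lemma schur_approx_bound (eta : nat -> R) (T : C) (n k : nat) :
  (forall j, (Rabs (eta j) <= 1)%R) -> (Cmod T < 1)%R ->
  (Cmod (schur_approx eta T n k) <= Cmod T)%R.
Proof.
intros He HT; revert k; induction n as [|n IH]; intros k; simpl; [lra|].
rewrite Cmod_mult.
assert (B := moebius_bound (eta k) (schur_approx eta T n (S k)) (He k) ltac:(specialize (IH (S k)); lra)).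
assert (T0 := Cmod_ge_0 T); nra.
Qed.

(** The Möbius map keeps the constant, and the multiplication by [T] in each of the [n] steps
    contributes one factor [Cmod T ^ 2]. The index [k] stays general since the recursion shifts
    it. *)
Lemma schur_approx_close (eta : nat -> R) (T : C) (h : nat -> C) :
  (forall j, (Rabs (eta j) <= 1)%R) -> (Cmod T < 1)%R ->
  (forall k, (Cmod (h k) <= 1)%R) ->
  (forall k, h k = moebius (eta k) (T * h (S k))) ->
  forall n k, hyp_close (4 / (1 - Cmod T ^ 2) ^ 2 * (Cmod T ^ 2) ^ n)
    (schur_approx eta T n k) (T * h k).
Proof.
intros He HT Hh Hrec.
assert (T0 := Cmod_ge_0 T).
assert (T1 : (0 < 1 - Cmod T ^ 2)%R) by nra.
assert (Hu : forall k, (Cmod (T * h k) <= Cmod T)%R).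
{ intros k; rewrite Cmod_mult; specialize (Hh k); nra. }
assert (C0 : (0 < 4 / (1 - Cmod T ^ 2) ^ 2)%R) by (apply Rdiv_lt_0_compat; [lra | apply pow_lt, T1]).
induction n as [|n IH]; intros k.
(* Source of the constant: [T] and [T * h k] are at distance at most 2, and both defects are at
   least [1 - Cmod T ^ 2]. *)
- unfold hyp_close; cbn [schur_approx]; rewrite pow_O.
  assert (A : (Cmod (T - T * h k) <= 2)%R).
  { unfold Cminus; eapply Rle_trans; [apply Cmod_triangle|]; rewrite Cmod_opp.
    specialize (Hu k); lra. }
  assert (A0 := Cmod_ge_0 (T - T * h k)).
  assert (B : (1 - Cmod T ^ 2 <= 1 - Cmod (T * h k) ^ 2)%R).
  { specialize (Hu k); assert (Z := Cmod_ge_0 (T * h k)); nra. }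
  apply Rle_trans with 4%R; [nra|].
  replace 4%R with (4 / (1 - Cmod T ^ 2) ^ 2 * 1 * ((1 - Cmod T ^ 2) * (1 - Cmod T ^ 2)))%R at 1
    by (field; lra).
  apply Rmult_le_compat_l; [lra|]; apply Rmult_le_compat_l; lra.
- cbn [schur_approx]; rewrite (Hrec k).
  replace (4 / (1 - Cmod T ^ 2) ^ 2 * (Cmod T ^ 2) ^ S n)%R
    with (4 / (1 - Cmod T ^ 2) ^ 2 * (Cmod T ^ 2) ^ n * Cmod T ^ 2)%R by (simpl; ring).
  assert (B := schur_approx_bound eta T n (S k) He HT); specialize (Hu (S k)).
  apply hyp_close_scale.
  + apply Rmult_le_pos; [lra|]; apply pow_le, pow_le, T0.
  + lra.
  + apply moebius_bound; [apply He | lra].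
  + apply moebius_bound; [apply He | lra].
  + apply hyp_close_moebius; [apply He | lra | lra | apply IH].
Qed.

(** Both defects are at most 1, so the hyperbolic estimate also bounds the squared Euclidean
    distance, at a geometric rate. *)
Lemma schur_approx_limit (eta : nat -> R) (T : C) (h : nat -> C) (k : nat) :
  (forall j, (Rabs (eta j) <= 1)%R) -> (Cmod T < 1)%R ->
  (forall k, (Cmod (h k) <= 1)%R) ->
  (forall k, h k = moebius (eta k) (T * h (S k))) ->
  filterlim (fun n => schur_approx eta T n k) eventually (locally (T * h k)).
Proof.
intros He HT Hh Hrec.
assert (T0 := Cmod_ge_0 T).
assert (T1 : (0 < 1 - Cmod T ^ 2)%R) by nra.
assert (C0 : (0 < 4 / (1 - Cmod T ^ 2) ^ 2)%R) by (apply Rdiv_lt_0_compat; [lra | apply pow_lt, T1]).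
apply (filterlim_locally_ball_norm (K := C_AbsRing) (U := C_NormedModule)).
intros eps; assert (Pe := cond_pos eps).
destruct (pow_lt_1_zero (Cmod T ^ 2) ltac:(rewrite Rabs_pos_eq; nra)
  (eps ^ 2 / (4 / (1 - Cmod T ^ 2) ^ 2))%R) as [N HN].
{ apply Rdiv_lt_0_compat; [apply pow_lt, Pe | exact C0]. }
exists N; intros n Hn; specialize (HN n Hn).
change (Cmod (schur_approx eta T n k - T * h k) < eps)%R.
assert (HC := schur_approx_close eta T h He HT Hh Hrec n k); unfold hyp_close in HC.
set (K := (4 / (1 - Cmod T ^ 2) ^ 2)%R) in *.
assert (q0 : (0 <= (Cmod T ^ 2) ^ n)%R) by (apply pow_le, pow_le, T0).
rewrite Rabs_pos_eq in HN by exact q0.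
apply (Rmult_lt_compat_l K) in HN; [|exact C0].
replace (K * (eps ^ 2 / K))%R with (eps ^ 2)%R in HN by (field; lra).
assert (B1 := Cmod_ge_0 (schur_approx eta T n k)).
assert (B2 := schur_approx_bound eta T n k He HT).
assert (B3 := Cmod_ge_0 (T * h k)).
assert (B4 : (Cmod (T * h k) <= Cmod T)%R).
{ rewrite Cmod_mult; specialize (Hh k); nra. }
assert (D : ((1 - Cmod (schur_approx eta T n k) ^ 2) * (1 - Cmod (T * h k) ^ 2) <= 1 * 1)%R)
  by (apply Rmult_le_compat; nra).
assert (Q := Cmod_ge_0 (schur_approx eta T n k - T * h k)).
assert (0 <= K * (Cmod T ^ 2) ^ n)%R by (apply Rmult_le_pos; lra).
nra.
Qed.

(* The value 0 at index 0 makes [gcoef_schur_g] uniform in [k]. *)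
Definition schur_g (eta : nat -> R) (k : nat) : R :=
  match k with O => 0 | S _ => (1 - eta k) / 2 end.

Lemma gcoef_schur_g (eta : nat -> R) (k : nat) :
  gcoef (schur_g eta) (S k) = ((1 - schur_g eta k) * schur_g eta (S k))%R.
Proof. destruct k; simpl; ring. Qed.

Lemma two_neq_0 : RtoC 2 <> 0.
Proof. intros F; apply (f_equal fst) in F; simpl in F; lra. Qed.

(** For [x = T h], the expression [2 (T - x) / ((1 - T) (1 + x))] is
    [w / (1 + e^(z/2) (1 + h) / (1 - h))] in a form that stays meaningful at [h = 1]. The
    cancellation rests on [1 + eta * T - x * (T + eta)], the numerator both of the inner tail and of
    [1 + T * moebius eta x]. *)
Lemma gtail_schur_step (eta : R) (T x : C) (a : C) :
  (Rabs eta <= 1)%R -> (Cmod T < 1)%R -> (Cmod x < 1)%R ->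
  1 + a * ((1 - eta) / 2) * (4 * T / (1 - T) ^ 2) /
        (1 + (1 - (1 - eta) / 2) * (2 * (T - x) / ((1 - T) * (1 + x)))) =
  1 + a * (2 * (T - T * moebius eta x) / ((1 - T) * (1 + T * moebius eta x))).
Proof.
intros He HT Hx.
assert (N1 := one_minus_neq_0 T HT); assert (N2 := one_plus_neq_0 x Hx).
assert (N3 := one_minus_real_mult_neq_0 eta x He Hx).
assert (N4 : 1 + T * moebius eta x <> 0).
{ apply one_plus_neq_0; rewrite Cmod_mult.
  assert (B := moebius_bound eta x He Hx); assert (T0 := Cmod_ge_0 T); nra. }
assert (E4 : (1 + T * moebius eta x) * (1 - eta * x) = 1 + eta * T - x * (T + eta))
  by (unfold moebius; field; exact N3).
assert (N5 : 1 + eta * T - x * (T + eta) <> 0)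
  by (rewrite <- E4; apply Cmult_neq_0; assumption).
assert (N2' := two_neq_0).
assert (EA : 1 + (1 - (1 - eta) / 2) * (2 * (T - x) / ((1 - T) * (1 + x))) =
   (1 + eta * T - x * (T + eta)) / ((1 - T) * (1 + x)))
  by (field; repeat split; assumption).
assert (EB : 1 + T * moebius eta x = (1 + eta * T - x * (T + eta)) / (1 - eta * x))
  by (rewrite <- E4; field; exact N3).
rewrite EA, EB; unfold moebius; field; repeat split; assumption.
Qed.

Lemma gtail_schur (eta : nat -> R) (T : C) (n k : nat) :
  (forall j, (Rabs (eta j) <= 1)%R) -> (Cmod T < 1)%R ->
  gtail (schur_g eta) (4 * T / (1 - T) ^ 2) n (S k) =
  1 + (1 - schur_g eta k) *
    (2 * (T - schur_approx eta T n (S k)) / ((1 - T) * (1 + schur_approx eta T n (S k)))).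
Proof.
intros He HT; revert k; induction n as [|n IH]; intros k.
(* With no level left the approximant is [T] itself, so [T - T = 0] and the tail is 1. *)
- assert (N1 := one_minus_neq_0 T HT); assert (N2 := one_plus_neq_0 T HT).
  simpl; field; split; assumption.
- cbn [gtail schur_approx]; rewrite IH, gcoef_schur_g, <- gtail_schur_step.
  + rewrite RtoC_mult, RtoC_minus; unfold schur_g at 2 3.
    rewrite RtoC_div, RtoC_minus by lra; reflexivity.
  + apply He.
  + exact HT.
  + assert (B := schur_approx_bound eta T n (S (S k)) He HT); lra.
Qed.

(** The previous formula at [k = 0], where [schur_g eta 0 = 0] turns the factor in front into 1. The
    parameters start with [eta 1], and [(1 - T) / (1 + T)] is [e^(-z/2)] when [T] is
    [disc_map z]. *)
Lemma gtrunc_schur (eta : nat -> R) (T : C) (n : nat) :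
  (forall j, (Rabs (eta j) <= 1)%R) -> (Cmod T < 1)%R ->
  gtrunc (schur_g eta) n (4 * T / (1 - T) ^ 2) =
  (1 - T) / (1 + T) * ((1 + schur_approx eta T n 1) / (1 - schur_approx eta T n 1)).
Proof.
intros He HT; unfold gtrunc; rewrite gtail_schur by assumption.
assert (B := schur_approx_bound eta T n 1 He HT).
set (x := schur_approx eta T n 1) in *.
assert (N1 := one_minus_neq_0 T HT); assert (N2 := one_plus_neq_0 T HT).
assert (N3 := one_minus_neq_0 x ltac:(lra)); assert (N4 := one_plus_neq_0 x ltac:(lra)).
simpl schur_g.
assert (E : 1 + (1 - 0%R) * (2 * (T - x) / ((1 - T) * (1 + x))) =
  (1 + T) * (1 - x) / ((1 - T) * (1 + x))) by (field; split; assumption).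
rewrite E; field; repeat split; assumption.
Qed.

(** * Return to the variable w on the cut plane *)

Lemma Cexp_disc_map (z : C) : strip z ->
  Cexp z - 1 = 4 * disc_map z / (1 - disc_map z) ^ 2.
Proof.
intros Hz; assert (N := disc_map_1_minus_neq_0 z Hz).
replace z with (z / 2 + z / 2) at 1 by (field; apply two_neq_0).
rewrite Cexp_plus, half_exp_disc_map by exact Hz; field; exact N.
Qed.

(** The argument comes from the half-angle formula [tan (arg / 2) = v / (u + r)]: [2 * atan t]
    automatically lies strictly between [- PI] and [PI], and [u + r > 0] expresses that the point is
    off the cut. *)
Lemma Cexp_onto_cut_plane (w : C) : cut_plane w -> exists z, strip z /\ Cexp z - 1 = w.
Proof.
intros Hw; destruct w as [a v]; unfold cut_plane, Re, Im in Hw; simpl in Hw.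
set (u := (1 + a)%R); set (r := sqrt (u ^ 2 + v ^ 2)).
assert (H0 : (0 < u ^ 2 + v ^ 2)%R).
{ destruct (Req_dec v 0) as [->|n]; [|nra].
  assert (-1 < a)%R by (apply Rnot_le_lt; intros H; apply Hw; split; [reflexivity | exact H]).
  unfold u; nra. }
assert (Hr : (0 < r)%R) by (apply sqrt_lt_R0, H0).
assert (Hr2 : (r * r = u ^ 2 + v ^ 2)%R) by (apply sqrt_sqrt; lra).
assert (Hur : (0 < u + r)%R).
{ destruct (Rlt_dec 0 u) as [H|H]; [lra|].
  assert (v <> 0)%R by (intros E; apply Hw; split; [exact E | unfold u in H; lra]).
  nra. }
set (t := (v / (u + r))%R).
exists (ln r, 2 * atan t)%R; split.
- unfold strip, Im; simpl; assert (B := atan_bound t); apply Rabs_def1; lra.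
- rewrite Cexp_pair, exp_ln by exact Hr.
  assert (Ht : (0 < 1 + t²)%R) by (unfold Rsqr; nra).
  assert (S := sqrt_sqrt (1 + t²) ltac:(lra)); assert (S0 := sqrt_lt_R0 _ Ht).
  assert (Tv : (t * (u + r) = v)%R) by (unfold t; field; lra).
  assert (Tt : (t * t * (u + r) = r - u)%R).
  { apply Rmult_eq_reg_r with (u + r)%R; [|lra].
    replace (t * t * (u + r) * (u + r))%R with ((t * (u + r)) ^ 2)%R by ring; rewrite Tv; lra. }
  assert (Ec : (r * cos (2 * atan t) = u)%R).
  { rewrite cos_2a, cos_atan, sin_atan.
    replace (1 / sqrt (1 + t²) * (1 / sqrt (1 + t²)) - t / sqrt (1 + t²) * (t / sqrt (1 + t²)))%R
      with ((1 - t * t) / (sqrt (1 + t²) * sqrt (1 + t²)))%R by (field; lra).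
    rewrite S; unfold Rsqr in *; apply Rmult_eq_reg_r with (1 + t * t)%R; [|lra].
    replace (r * ((1 - t * t) / (1 + t * t)) * (1 + t * t))%R with (r * (1 - t * t))%R
      by (field; lra).
    apply Rmult_eq_reg_r with (u + r)%R; [|lra].
    replace (r * (1 - t * t) * (u + r))%R with (r * ((u + r) - t * t * (u + r)))%R by ring.
    replace (u * (1 + t * t) * (u + r))%R with (u * ((u + r) + t * t * (u + r)))%R by ring.
    rewrite Tt; ring. }
  assert (Es : (r * sin (2 * atan t) = v)%R).
  { rewrite sin_2a, cos_atan, sin_atan.
    replace (2 * (t / sqrt (1 + t²)) * (1 / sqrt (1 + t²)))%R
      with (2 * t / (sqrt (1 + t²) * sqrt (1 + t²)))%R by (field; lra).
    rewrite S; unfold Rsqr in *; apply Rmult_eq_reg_r with (1 + t * t)%R; [|lra].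
    replace (r * (2 * t / (1 + t * t)) * (1 + t * t))%R with (r * (2 * t))%R by (field; lra).
    apply Rmult_eq_reg_r with (u + r)%R; [|lra].
    replace (r * (2 * t) * (u + r))%R with (2 * r * (t * (u + r)))%R by ring.
    replace (v * (1 + t * t) * (u + r))%R with (v * ((u + r) + t * t * (u + r)))%R by ring.
    rewrite Tt, Tv; ring. }
  rewrite Ec, Es; apply injective_projections; simpl; unfold u; ring.
Qed.

(** A total limit, so that [G] can be defined from [w] alone, with no choice of a logarithm. *)
Definition C_Lim_seq (s : nat -> C) : C :=
  (real (Lim_seq (fun n => Re (s n))), real (Lim_seq (fun n => Im (s n)))).

Lemma C_Lim_seq_unique (s : nat -> C) (l : C) :
  filterlim s eventually (locally l) -> C_Lim_seq s = l.
Proof.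
intros H; unfold C_Lim_seq.
rewrite (is_lim_seq_unique (fun n => Re (s n)) (Re l)).
2: { apply (filterlim_comp _ _ _ s Re _ _ _ H), (continuous_Re (fun x => x)), continuous_id. }
rewrite (is_lim_seq_unique (fun n => Im (s n)) (Im l)).
2: { apply (filterlim_comp _ _ _ s Im _ _ _ H), (continuous_Im (fun x => x)), continuous_id. }
destruct l; reflexivity.
Qed.

Theorem theorem2p1 (theta : C -> C)
  (Hhol : holomorphic_on strip theta)
  (Hbound : forall z : C, strip z -> (Cmod (theta z) < 1)%R)
  (Hreal : forall x : R, exists y : R, theta (RtoC x) = RtoC y) :
  exists (g : nat -> R) (G : C -> C),
    (forall k : nat, (1 <= k)%nat -> (0 <= g k <= 1)%R) /\
    (forall w : C, cut_plane w -> is_gfraction g w (G w)) /\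
    let mu := ((1 + theta 0) / (1 - theta 0))%C in
    forall z : C, strip z ->
      theta z = (1 - 2 / (mu * Cexp (z / 2) * G (Cexp z - 1) + 1))%C.
Proof.
destruct (dependent_choice (C -> C) (fun _ h => real_schur h)
  (fun _ h h' => forall z, strip z ->
    h z * (1 - Re (h 0) * (disc_map z * h' z)) = Re (h 0) - disc_map z * h' z)
  (fun z => - theta z)) as [h [h0 Hh]].
{ split; [|split].
  - intros z Hz; apply Cdiff_opp, ex_derive_Cdiff, Hhol, Hz.
  - intros z Hz; rewrite Cmod_opp; apply Rlt_le, Hbound, Hz.
  - intros x; destruct (Hreal x) as [y ->]; unfold Im; simpl; ring. }
{ intros _ u Hu; apply schur_step, Hu. }
set (eta := fun k => Re (h k 0)).
assert (He : forall k, (Rabs (eta k) <= 1)%R) by (intros k; apply real_schur_0, Hh).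
assert (Hb : forall k z, strip z -> (Cmod (h k z) <= 1)%R) by (intros k; apply Hh).
assert (Hu : forall k z, strip z -> (Cmod (disc_map z * h k z) < 1)%R).
{ intros k z Hz; rewrite Cmod_mult.
  assert (A := disc_map_lt_1 z Hz); assert (B := Hb k z Hz); assert (D := Cmod_ge_0 (h k z));
    assert (E := Cmod_ge_0 (disc_map z)); nra. }
assert (Hrec : forall k z, strip z -> h k z = moebius (eta k) (disc_map z * h (S k) z)).
{ intros k z Hz; assert (N := one_minus_real_mult_neq_0 _ _ (He k) (Hu (S k) z Hz)).
  assert (R := proj2 (Hh k) z Hz); cbv beta in R; change (Re (h k 0)) with (eta k) in R.
  unfold moebius; rewrite <- R; field; exact N. }
set (g := schur_g eta).
set (L := fun z => (1 - disc_map z) / (1 + disc_map z) *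
  ((1 + disc_map z * h 1%nat z) / (1 - disc_map z * h 1%nat z))).
assert (HL : forall z, strip z -> is_gfraction g (Cexp z - 1) (L z)).
{ intros z Hz; assert (HT := disc_map_lt_1 z Hz); unfold is_gfraction.
  rewrite Cexp_disc_map by exact Hz.
  apply (filterlim_ext (fun n => (1 - disc_map z) / (1 + disc_map z) *
    ((1 + schur_approx eta (disc_map z) n 1) / (1 - schur_approx eta (disc_map z) n 1)))).
  { intros n; symmetry; apply gtrunc_schur; assumption. }
  apply (filterlim_comp _ _ _ (fun n => schur_approx eta (disc_map z) n 1)
    (fun x => (1 - disc_map z) / (1 + disc_map z) * ((1 + x) / (1 - x)))
    _ (locally (disc_map z * h 1%nat z))).
  - apply (schur_approx_limit eta (disc_map z) (fun k => h k z)); auto.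
  - apply (continuous_Cmult (fun _ => (1 - disc_map z) / (1 + disc_map z))
      (fun x => (1 + x) / (1 - x))); [apply continuous_const|].
    apply continuous_Cdiv.
    + apply continuous_Cplus; [apply continuous_const | apply continuous_id].
    + apply continuous_Cminus; [apply continuous_const | apply continuous_id].
    + apply one_minus_neq_0, Hu, Hz. }
set (G := fun w => C_Lim_seq (fun n => gtrunc g n w)).
assert (HG : forall z, strip z -> G (Cexp z - 1) = L z).
{ intros z Hz; apply C_Lim_seq_unique, HL, Hz. }
exists g, G; split; [|split].
- intros [|k] Hk; [lia|]; unfold g, schur_g.
  assert (B := proj1 (Rabs_le_between _ _) (He (S k))); lra.
- intros w Hw; destruct (Cexp_onto_cut_plane w Hw) as [z [Hz <-]].
  rewrite HG by exact Hz; apply HL, Hz.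
- intros mu z Hz; rewrite HG by exact Hz; rewrite half_exp_disc_map by exact Hz.
  assert (Et : theta 0 = - eta O).
  { assert (E := proj1 (real_schur_0 (h O) (proj1 (Hh O)))); unfold eta; rewrite <- E, h0; ring. }
  assert (Ez : theta z = - moebius (eta O) (disc_map z * h 1%nat z))
    by (rewrite <- Hrec by exact Hz; rewrite h0; ring).
  assert (HT := disc_map_lt_1 z Hz).
  (* The strict bound on [theta] excludes [eta O = -1], where the denominator of [mu] would vanish;
     later parameters may reach 1 or -1. *)
  assert (N0 : 1 + eta O <> 0).
  { replace (1 + eta O) with (1 - theta 0) by (rewrite Et; ring).
    apply one_minus_neq_0, Hbound, strip_0. }
  assert (N1 := one_minus_neq_0 _ HT); assert (N2 := one_plus_neq_0 _ HT).
  assert (N3 := one_minus_neq_0 _ (Hu 1%nat z Hz)).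
  assert (N4 := one_minus_real_mult_neq_0 _ _ (He O) (Hu 1%nat z Hz)).
  assert (N5 := two_neq_0).
  rewrite Ez; unfold mu, L; rewrite Et.
  set (x := disc_map z * h 1%nat z) in *; set (T := disc_map z) in *.
  (* [(1 + T) / (1 - T)] is [e^(z/2)] and cancels the prefactor of [L z]. The sum equals
     [2 / (1 - theta z)], so inverting it gives the claim. *)
  assert (E : (1 + - eta O) / (1 - - eta O) * ((1 + T) / (1 - T)) *
    ((1 - T) / (1 + T) * ((1 + x) / (1 - x))) + 1 =
    2 * (1 - eta O * x) / ((1 + eta O) * (1 - x))).
  { replace (1 - - eta O) with (1 + eta O) by ring; field; repeat split; assumption. }
  rewrite E; unfold moebius; field; repeat split; assumption.
Qed.
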